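(* Let $n\in\mathbb{N}^+$ and let $K$ be a weakly self-similar compact metric space such that $\dim_t K\geq n$. Then for the generic $f\in C_n(K)$, for every $y\in\operatorname{int} f(K)$, $$\dim_H f^{-1}(y)=\dim_{t^nH}K-n.$$
   Context: A compact metric space $K$ is weakly self-similar if for all $x\in K$ and $r>0$ there exist a compact set $K_{x,r}\subseteq B(x,r)$ and a bi-Lipschitz map $\phi_{x,r}\colon K_{x,r}\to K$; here $B(x,r)$ is the closed ball $\{y: d(x,y)\leq r\}$, and a map is called bi-Lipschitz if it is a bijection (so $\phi_{x,r}$ is onto $K$) and both it and its inverse are Lipschitz. $\operatorname{int} f(K)$ is the interior of $f(K)$ in $\mathbb{R}^n$. $\mathbb{N}=\{0,1,2,\dots\}$ and $\mathbb{N}^+=\{1,2,\dots\}$. $\dim_H$ is Hausdorff dimension, with the convention $\dim_H\emptyset=-1$. $\dim_t$ is the small inductive topological dimension: $\dim_t\emptyset=-1$ and, for a non-empty metric space $X$, $\dim_t X=\inf\{d: X \text{ has a basis } \mathcal{U} \text{ such that } \dim_t\partial U\leq d-1 \text{ for every } U\in\mathcal{U}\}$. The $n$th inductive topological Hausdorff dimension is defined by $\dim_{t^nH}\emptyset=-1$ for all $n\in\mathbb{N}$, and for non-empty $X$ by $\dim_{t^0H}X=\dim_H X$ and, for $n\geq 1$, $\dim_{t^nH}X=\inf\{d: X\text{ has a basis }\mathcal{U}\text{ such that }\dim_{t^{n-1}H}\partial U\leq d-1\text{ for every }U\in\mathcal{U}\}$. All these dimensions may take the value $\infty$ (so $d=\infty$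 is allowed in the infima), with $\infty-c=\infty$ for finite $c$. $C_n(K)$ is the complete metric space of continuous functions $K\to\mathbb{R}^n$ with the supremum norm. A property holds for the generic element of a complete metric space if the set of elements having it is co-meager. *)

(* Defs.v *)
From HB Require Import structures.
From mathcomp Require Import all_boot all_order all_algebra.
From mathcomp Require Import all_classical all_reals all_analysis.

Set Implicit Arguments.
Unset Strict Implicit.
Unset Printing Implicit Defensive.

Import Order.TTheory GRing.Theory Num.Theory.
Import numFieldNormedType.Exports.

Local Open Scope classical_set_scope.
Local Open Scope ring_scope.

Definition nowhere_dense (T : topologicalType) (A : set T) :=
  (closure A)° = set0.

Definition meager (T : topologicalType) (A : set T) :=
  exists2 F : nat -> set T,
    (forall i, nowhere_dense (F i)) & A = \bigcup_i F i.

Definition comeager (T : topologicalType) (A : set T) := meager (~` A).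

Definition boundary (T : topologicalType) (A : set T) := closure A `\` A°.

(* A subset [A] of [T] is seen as a space through [set_type A], which carries
   the topology induced by [T]. A boundary taken in this space is mapped back to
   a subset of [T], so that the recursive definitions below never leave [T]. *)
Definition boundary_in (T : topologicalType) (A : set T) (U : set A) : set T :=
  set_val @` boundary U.

(* [small_ind_lt k A] means dim_t A <= k - 1. *)
Fixpoint small_ind_lt (T : topologicalType) (k : nat) (A : set T) : Prop :=
  if k is j.+1 then
    exists2 B : set (set A), basis B &
      forall U, B U -> small_ind_lt j (boundary_in U)
  else A = set0.

(* By [dim_t_le], [dim_t0] and [dim_tE] below, this is the usual recursively
   defined small inductive dimension. *)
Definition dim_t (R : realType) (T : topologicalType) (A : set T) : \bar R :=
  ereal_inf [set (k%:R - 1)%:E | k in [set k | small_ind_lt k A]].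

Arguments dim_t {R T} A.

Section dim_t_theory.
Context {R : realType} {T : topologicalType}.
Implicit Types A : set T.

Lemma boundary_in0 (U : set (set0 : set T)) : boundary_in U = set0.
Proof. by rewrite -subset0 => x [[y yP] _ _]; move: (set_mem yP). Qed.

Lemma small_ind_ltS k A : small_ind_lt k A -> small_ind_lt k.+1 A.
Proof.
elim: k A => [A /= ->|k IH A [B Bb Bk]].
  exists [set U | open U]; last by move=> U _; exact: boundary_in0.
  split=> // x; have := set_mem (valP x); by [].
by exists B => // U /Bk/IH.
Qed.

Lemma small_ind_lt_leq j k A : (j <= k)%N -> small_ind_lt j A -> small_ind_lt k A.
Proof.
move=> jk Aj; rewrite -(subnK jk); elim: (k - j)%N => // i IH.
by rewrite addSn; exact: small_ind_ltS.
Qed.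

Lemma dim_t_le k A :
  (dim_t A <= (k%:R - 1 : R)%:E)%E <-> small_ind_lt k A.
Proof.
split=> [Ak|Ak]; last by apply: ereal_inf_lbound; exists k.
have : (dim_t A < (k.+1%:R - 1 : R)%:E)%E.
  by rewrite (le_lt_trans Ak)// lte_fin ltrD2r ltr_nat.
move=> /ereal_inf_lt[_ [j Aj <-]]; rewrite lte_fin ltrD2r ltr_nat ltnS => jk.
exact: small_ind_lt_leq jk Aj.
Qed.

Lemma dim_t_geN1 A : ((-1)%:E <= dim_t A :> \bar R)%E.
Proof. by apply: le_ereal_inf_tmp => _ [k _ <-]; rewrite lee_fin lerBrDr addNr. Qed.

Lemma dim_t0 : dim_t (set0 : set T) = (-1)%:E :> \bar R.
Proof.
apply/eqP; rewrite eq_le dim_t_geN1 andbT.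
by apply: ereal_inf_lbound; exists 0%N => //=; rewrite sub0r.
Qed.

Lemma dim_tE A : A !=set0 ->
  dim_t A = ereal_inf [set d : \bar R | exists2 B : set (set A), basis B &
    forall U, B U -> (dim_t (boundary_in U) <= d - 1)%E].
Proof.
move=> [a Aa]; apply/eqP; rewrite eq_le; apply/andP; split.
  apply: le_ereal_inf_tmp => d [B Bb Bd].
  have [U BU] : B !=set0.
    have [_ /(_ (SigSub (mem_set Aa)) setT)] := Bb.
    by move=> /(_ filterT) [U [BU _] _]; exists U.
  case: d Bd => [r||] Bd; last 2 first.
  - exact: leey.
  - by have := le_trans (dim_t_geN1 _) (Bd _ BU).
  have r0 : 0 <= r.
    by have := le_trans (dim_t_geN1 _) (Bd _ BU); rewrite lee_fin lerBrDr addNr.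
  pose k := Num.truncn r.
  have kr : k%:R <= r by rewrite truncn_le.
  apply: (@le_trans _ _ (k%:R)%:E); last by rewrite lee_fin.
  have -> : k%:R = k.+1%:R - 1 :> R by rewrite -natr1 addrK.
  apply/dim_t_le; exists B => // V BV.
  have : (dim_t (boundary_in V) < (k.+1%:R - 1 : R)%:E)%E.
    by rewrite (le_lt_trans (Bd _ BV))// lte_fin ltrD2r truncnS_gt.
  move=> /ereal_inf_lt[_ [j Aj <-]]; rewrite lte_fin ltrD2r ltr_nat ltnS => jk.
  exact: small_ind_lt_leq jk Aj.
apply: le_ereal_inf_tmp => _ [[|k] /= Ak <-]; first by rewrite Ak in Aa.
have [B Bb Bk] := Ak.
apply: ereal_inf_lbound; exists B => // U /Bk Uk.
by rewrite -natr1 addrK; apply/dim_t_le.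
Qed.

End dim_t_theory.

Section hausdorff_dimension.
Context {R : realType} {T : metricType R}.
Implicit Types (A : set T) (s d : R).

Definition ediam A : \bar R :=
  ereal_sup [set (mdist x y)%:E | x in A & y in A].

(* (diam A)^s, with 0^0 = 1 for non-empty sets; empty sets contribute nothing
   to a cover, even for s = 0. *)
Definition diam_pow s A : \bar R :=
  if `[< A = set0 >] then 0%E else poweR (ediam A) s.

Definition hausdorff_premeasure s d A : \bar R :=
  ereal_inf [set (\sum_(0 <= i <oo) diam_pow s (U i))%E | U in
    [set U : nat -> set T |
      A `<=` \bigcup_i U i /\ forall i, (ediam (U i) <= d%:E)%E]].

Definition hausdorff_measure s A : \bar R :=
  ereal_sup [set hausdorff_premeasure s d A | d in [set d | 0 < d]].

Definition dim_H A : \bar R :=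
  if `[< A = set0 >] then (-1)%:E
  else ereal_inf
    [set s%:E | s in [set s | 0 <= s /\ hausdorff_measure s A = 0%E]].

Fixpoint dim_tH (n : nat) (A : set T) : \bar R :=
  if `[< A = set0 >] then (-1)%:E
  else if n is m.+1 then
    ereal_inf [set d : \bar R | exists2 B : set (set A), basis B &
      forall U, B U -> (dim_tH m (boundary_in U) <= d - 1)%E]
  else dim_H A.

End hausdorff_dimension.

Definition lipschitz_in (R : realType) (S T : metricType R) (A : set S)
    (f : S -> T) :=
  exists L : R, forall x y, A x -> A y -> mdist (f x) (f y) <= L * mdist x y.

(* Bi-Lipschitz bijection from A onto B; the values of [f] outside A, and of its
   inverse [g] outside B, are irrelevant. *)
Definition bilipschitz (R : realType) (S T : metricType R) (A : set S)
    (B : set T) (f : S -> T) :=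
  [/\ set_bij A B f, lipschitz_in A f &
      exists2 g : T -> S, {in A, cancel f g} & lipschitz_in B g].

(* The closed ball is spelled out since the library's [closed_ball] is the
   closure of the open ball, which can be smaller in a general metric space. *)
Definition weakly_self_similar (R : realType) (K : metricType R) :=
  forall (x : K) (r : R), 0 < r ->
    exists C : set K, [/\ compact C, C `<=` [set y | mdist x y <= r] &
      exists phi : K -> K, bilipschitz C [set: K] phi].

(* The topology is that of uniform convergence; for compact K it is the one of
   the supremum norm ([nbhs_CfunP]). The norm of ['rV[R]_n] is the maximum norm,
   which gives the same topology on C_n(K) as the Euclidean one. *)
Definition Cfun (R : realType) (K : topologicalType) (n : nat) : Type :=
  continuousType K 'rV[R]_n.

HB.instance Definition _ (R : realType) (K : topologicalType) (n : nat) :=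
  Topological.copy (Cfun R K n)
    (initial_topology
      (id : continuousType K 'rV[R]_n -> arrow_uniform_type K 'rV[R]_n)).

Definition Cfun_fun (R : realType) (K : topologicalType) (n : nat)
  (f : Cfun R K n) : K -> 'rV[R]_n := (f : continuousType K 'rV[R]_n).
Coercion Cfun_fun : Cfun >-> Funclass.

Definition sup_dist (R : realType) (K : topologicalType) (n : nat)
    (f g : Cfun R K n) : R := sup [set `|f x - g x| | x in [set: K]].

Lemma nbhs_CfunP (R : realType) (K : topologicalType) (n : nat)
    (cK : compact [set: K]) (f : Cfun R K n) (A : set (Cfun R K n)) :
  nbhs f A <-> exists2 e : R, 0 < e & [set g | sup_dist f g < e] `<=` A.
Proof.
have bnd (g : Cfun R K n) : has_ubound [set `|f x - g x| | x in [set: K]].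
  have : compact ((fun x => `|f x - g x|) @` [set: K]).
    apply: continuous_compact => //; apply: continuous_subspaceT => x.
    apply: (@continuous_comp _ _ _ (fun x => f x - g x)); last exact: norm_continuous.
    by apply: cvgB; apply: cts_fun.
  move=> /compact_bounded [M [_ /(_ (M + 1))]]; rewrite ltrDl ltr01 => /(_ isT) Mb.
  by exists (M + 1) => y /Mb; apply: le_trans; exact: ler_norm.
have nE : nbhs f A <-> exists2 e : R, 0 < e &
    [set g : Cfun R K n | forall x, ball (f x) e (g x)] `<=` A.
  split=> [[_ [[W oW <-] Wf WA]]|[e e0 eA]].
    have : nbhs (f : arrow_uniform_type K 'rV[R]_n) W.
      by apply: open_nbhs_nbhs; split.
    rewrite -nbhs_ballE => -[e e0 eW]; exists e => // g fg.
    by apply: WA; apply: eW.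
  have := @nbhsx_ballx R (arrow_uniform_type K 'rV[R]_n)
    (f : continuousType K 'rV[R]_n) e e0.
  rewrite nbhsE => -[W [oW Wf] We].
  exists ((id : continuousType K 'rV[R]_n -> arrow_uniform_type K 'rV[R]_n) @^-1` W).
  split; [by exists W|by []|].
  by move=> g /= Wg; apply: eA; exact: (We _ Wg).
split.
  move=> /nE[e e0 eA]; exists e => // g /= fg; apply: eA => x.
  rewrite -ball_normE /=; apply: le_lt_trans fg.
  by apply: ub_le_sup => //; exists x.
move=> [e e0 eA]; apply/nE; exists (e / 2); first by rewrite divr_gt0.
move=> g fg; apply: eA => /=; rewrite /sup_dist.
apply: (@le_lt_trans _ _ (e / 2)); last by rewrite ltr_pdivrMr// ltr_pMr// ltr1n.
have [->|/set0P S0] := eqVneq [set `|f x - g x| | x in [set: K]] set0.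
  by rewrite sup0 divr_ge0// ltW.
apply: ge_sup => // _ [x _ <-]; apply: ltW.
by have := fg x; rewrite -ball_normE.
Qed.

(* Main.v *)
Require Import Defs.
From HB Require Import structures.
From mathcomp Require Import all_boot all_order all_algebra.
From mathcomp Require Import all_classical all_reals all_analysis.
From mathcomp Require Import ring lra.

Set Implicit Arguments.
Unset Strict Implicit.
Unset Printing Implicit Defensive.

Import Order.TTheory GRing.Theory Num.Theory.
Import numFieldNormedType.Exports.

Local Open Scope classical_set_scope.
Local Open Scope ring_scope.

(** Write [H^s_oo] for Hausdorff content; it is handled through covers by
    finitely many balls, which suffice for compact sets and make conditions on
    fibers stable under small perturbations of the map.

    Upper bound. If [dim_tH n A < s + n], then maps into [R^n] all of whose fibers
    meet [A] in a set of small [H^s_oo] are dense, by induction on [n]: cover [A]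
    by finitely many small basic open sets, make the fibers of the first [n]
    coordinates small on a neighborhood of their boundaries, and make the last
    coordinate constant, with distinct values, on the separated pieces left over.

    Lower bound. Conversely, if maps whose fiber over [0] has small [H^s_oo] on [A]
    are dense, then [dim_tH n A <= s + n]: by separability and Baire, every
    function [dist x - e/2] is close to some [h] such that [A `&` {h = 0}] has the
    same property for [n - 1], and [{h < 0}] is the required neighborhood of [x].
    Hence, if [s + n < dim_tH n K], some map [F] has a fiber over [0] that stays
    large under perturbation. Given a map [f] whose range contains a cube [Q], plant
    rescaled copies of [F] in small bi-Lipschitz copies of [K] around finitely
    many points whose images form a fine net: all fibers over [Q] of the new map,
    and of all maps near it, are large. *)

(** * Neighborhoods and open balls in a metric space *)

Section metric_basics.
Context {R : realType} {K : metricType R}.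
Implicit Types (x y z : K) (A B : set K).

Lemma near_mdistP x (P : set K) :
  (\forall z \near x, P z) <-> exists2 e : R, 0 < e & [set z | mdist x z < e] `<=` P.
Proof.
split=> [/metricType_numDomainType.nbhs_mdistP[e e0 eP]|[e e0 eP]]; first by exists e.
by apply/metricType_numDomainType.nbhs_mdistP; exists e.
Qed.

Lemma near_mdist x (e : R) : 0 < e -> \forall z \near x, mdist x z < e.
Proof. by move=> e0; apply/near_mdistP; exists e. Qed.

Lemma open_mdist_lt x (e : R) : open [set z | mdist x z < e].
Proof.
rewrite openE => z /= xz; apply/near_mdistP; exists (e - mdist x z).
  by rewrite subr_gt0.
by move=> w /= zw; rewrite (le_lt_trans (metric_triangle x z w))// -ltrBrDl.
Qed.

End metric_basics.

(** * Hausdorff content by finite ball covers, and its relation to [dim_H] *)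

Section ball_content.
Context {R : realType} {K : metricType R}.
Implicit Types (x y z : K) (A B : set K) (s c : R) (l : seq (K * R)).

Definition ball_cover l : set K :=
  [set z | exists2 p, p \in l & mdist p.1 z < p.2].

(** Radii stand in for diameters, which is harmless where only arbitrarily small bounds matter. The
    centers may lie outside [A]. *)
Definition content_lt s c A := exists l,
  [/\ all (fun p => 0 < p.2) l, A `<=` ball_cover l & \sum_(p <- l) p.2 `^ s < c].

Lemma open_ball_cover l : open (ball_cover l).
Proof.
have -> : ball_cover l = \bigcup_(p in [set p | p \in l]) [set z | mdist p.1 z < p.2].
  by apply/seteqP; split=> z [p pl pz]; exists p.
by apply: bigcup_open => p _; exact: open_mdist_lt.
Qed.

Lemma content_ltS s c A B : A `<=` B -> content_lt s c B -> content_lt s c A.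
Proof. by move=> AB [l [l0 Bl ls]]; exists l; split=> //; exact: subset_trans Bl. Qed.

Lemma content_lt_le s c c' A : c <= c' -> content_lt s c A -> content_lt s c' A.
Proof. by move=> cc' [l [l0 Al ls]]; exists l; split=> //; exact: lt_le_trans cc'. Qed.

Lemma content_lt_set0 s c : 0 < c -> content_lt s c (set0 : set K).
Proof. by move=> c0; exists [::]; split=> //; rewrite big_nil. Qed.

Lemma content_lt_ball s c x r : 0 < r -> r `^ s < c ->
  content_lt s c [set z | mdist x z < r].
Proof.
move=> r0 rc; exists [:: (x, r)]; split=> /=; first by rewrite r0.
  by move=> z /= xz; exists (x, r) => //; rewrite inE.
by rewrite big_seq1.
Qed.

Lemma content_ltU s c c' A B : content_lt s c A -> content_lt s c' B ->
  content_lt s (c + c') (A `|` B).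
Proof.
move=> [l [l0 Al ls]] [l' [l'0 Bl' l's]]; exists (l ++ l'); split.
- by rewrite all_cat l0.
- by move=> z [/Al|/Bl'] [p pl pz]; exists p => //; rewrite mem_cat pl ?orbT.
- by rewrite big_cat ltrD.
Qed.

Lemma content_lt_open s c A : content_lt s c A ->
  exists W : set K, [/\ open W, A `<=` W & content_lt s c W].
Proof.
move=> [l [l0 Al ls]]; exists (ball_cover l); split=> //.
  exact: open_ball_cover.
by exists l; split.
Qed.

Lemma diam_pow_ge0 s A : (0 <= diam_pow s A)%E.
Proof. by rewrite /diam_pow; case: ifP => // _; exact: poweR_ge0. Qed.

Lemma hausdorff_premeasure_ge0 s d A : (0 <= hausdorff_premeasure s d A)%E.
Proof.
by apply: le_ereal_inf_tmp => _ [U _ <-]; apply: nneseries_ge0 => *; exact: diam_pow_ge0.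
Qed.

Lemma mdist_le_ediam A x y : A x -> A y -> ((mdist x y)%:E <= ediam A)%E.
Proof. by move=> Ax Ay; apply: ereal_sup_ubound; exists x => //; exists y. Qed.

Lemma ediam_ball x r : (ediam [set z | (mdist x z < r)%R] <= (r + r)%:E)%E.
Proof.
apply: ge_ereal_sup => _ [y /= xy [z /= xz <-]]; rewrite lee_fin.
by rewrite (le_trans (metric_triangle y x z))// lerD ?ltW// metric_sym.
Qed.

Lemma sum_geometric_half (c : R) n : 0 <= c -> \sum_(i < n) c / 2 ^+ i.+1 <= c.
Proof.
move=> c0; suff -> : \sum_(i < n) c / 2 ^+ i.+1 = c - c / 2 ^+ n.
  by rewrite gerBl divr_ge0// exprn_ge0.
elim: n => [|n IH]; first by rewrite big_ord0 expr0 divr1 subrr.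
rewrite big_ord_recr/= IH exprS invfM; set t := (2 ^+ n)^-1.
by field.
Qed.

(** With [d] the diameter of a nonempty [A], the radius [(d^s' + e)^(1/s)] exceeds [d] because
    [d^s <= d^s'] for [d <= 1]; the term [e] keeps it positive when [d = 0]. Separating [s'] from
    [s] includes the case [s' = 0]. *)
Lemma ball_of_diam_pow s' s e (x0 : K) A : 0 <= s' -> s' <= s -> 0 < s -> 0 < e ->
  (ediam A <= 1)%E ->
  exists p : K * R, [/\ 0 < p.2, A `<=` [set z | mdist p.1 z < p.2] &
    ((p.2 `^ s)%:E <= diam_pow s' A + e%:E)%E].
Proof.
move=> s'0 s's s0 e0 A1.
have powK t : 0 <= t -> (t `^ s^-1) `^ s = t.
  by move=> t0; rewrite -powRrM mulVf ?gt_eqF// powRr1.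
have [->|/set0P[x Ax]] := eqVneq A set0.
  exists (x0, e `^ s^-1); split=> //=; first exact: powR_gt0.
  by rewrite powK ?(ltW e0)// /diam_pow asboolT// add0e.
have : ((mdist x x)%:E <= ediam A)%E by exact: mdist_le_ediam.
rewrite mdistxx; case Ed : (ediam A) => [d||] // d0; last by rewrite Ed in A1.
rewrite Ed lee_fin in A1; rewrite lee_fin in d0.
have t0 : 0 < d `^ s' + e by rewrite ltr_wpDl// powR_ge0.
exists (x, (d `^ s' + e) `^ s^-1); split=> /=; first exact: powR_gt0.
- move=> z Az /=; have xz : mdist x z <= d.
    by rewrite -lee_fin -Ed; exact: mdist_le_ediam.
  apply: (le_lt_trans xz); rewrite ltNge; apply/negP => /(ge0_ler_powR (ltW s0)).
  rewrite !nnegrE powR_ge0 d0 => /(_ isT isT); rewrite powK ?(ltW t0)//.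
  apply/negP; rewrite -ltNge; suff : d `^ s <= d `^ s'.
    by move=> /le_lt_trans; apply; rewrite ltrDl.
  have [->|dn0] := eqVneq d 0; first by rewrite powR0 ?gt_eqF// powR_ge0.
  by apply: ger_powR s's; rewrite lt_neqAle eq_sym dn0 d0.
- rewrite powK ?(ltW t0)// /diam_pow asboolF; last by move=> A0; rewrite A0 in Ax.
  by rewrite Ed poweR_EFin.
Qed.

(** A countable cover of total less than [c / 2] is enlarged to open balls, the [i]-th one at an
    extra cost of [c / 2 / 2^(i+1)]; compactness leaves finitely many of them. *)
Lemma hausdorff_measure0_content_lt s' s c A : compact A -> 0 <= s' -> s' <= s ->
  0 < s -> 0 < c -> hausdorff_measure s' A = 0%E -> content_lt s c A.
Proof.
move=> cA s'0 s's s0 c0 mA.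
have [->|/set0P[x0 Ax0]] := eqVneq A set0; first exact: content_lt_set0.
have : (hausdorff_premeasure s' 1 A < (c / 2)%:E)%E.
  rewrite (@le_lt_trans _ _ 0%E) ?lte_fin ?divr_gt0// -mA.
  by apply: ereal_sup_ubound; exists 1 => /=.
move=> /ereal_inf_lt[_ [U [AU U1] <-] Uc].
have /choice[p pP] : forall i, exists p : K * R,
    [/\ 0 < p.2, U i `<=` [set z | mdist p.1 z < p.2] &
    ((p.2 `^ s)%:E <= diam_pow s' (U i) + (c / 2 / 2 ^+ i.+1)%:E)%E].
  by move=> i; apply: ball_of_diam_pow => //; rewrite !divr_gt0// exprn_gt0.
have : \forall N \near \oo, A `<=` [set z | exists2 i, (i < N)%N & mdist (p i).1 z < (p i).2].
  have /compact_near_coveringP := cA; apply => x /AU[i _ Ux].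
  have [_ /(_ _ Ux) pix _] := pP i.
  exists ([set z | mdist (p i).1 z < (p i).2], [set N | (i < N)%N]) => /=.
    split; last exact: nbhs_infty_gt.
    by apply: open_nbhs_nbhs; split => //; exact: open_mdist_lt.
  by move=> [z N] /= [pz iN]; exists i.
move=> [N _ /(_ N (leqnn N)) AN].
exists [seq p i | i <- index_iota 0 N]; split.
- by apply/allP => _ /mapP[i _ ->]; have [] := pP i.
- move=> z /AN[i iN pz]; exists (p i) => //.
  by apply/mapP; exists i => //; rewrite mem_index_iota.
- rewrite big_map -lte_fin -sumEFin [X in (X < _)%E](_ : _ = \sum_(i < N) (((p i).2 `^ s)%:E))%E; last first.
    by rewrite big_mkord.
  apply: (@le_lt_trans _ _ (\sum_(i < N) (diam_pow s' (U i) + (c / 2 / 2 ^+ i.+1)%:E))%E).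
    by apply: lee_sum => i _; have [] := pP i.
  rewrite big_split/= [c in (_ < c%:E)%E]splitr EFinD.
  rewrite sumEFin; apply: lte_leD => //; last first.
    by rewrite lee_fin; apply: sum_geometric_half; rewrite divr_ge0// ltW.
  apply: le_lt_trans Uc; rewrite -(big_mkord xpredT (fun i => diam_pow s' (U i))).
  by apply: nneseries_lim_ge => *; exact: diam_pow_ge0.
Qed.

Lemma content_lt_hausdorff_measure0 s A : 0 < s ->
  (forall c, 0 < c -> content_lt s c A) -> hausdorff_measure s A = 0%E.
Proof.
move=> s0 Ac; apply/eqP; rewrite eq_le; apply/andP; split; last first.
  apply: (@le_trans _ _ (hausdorff_premeasure s 1 A)).
    exact: hausdorff_premeasure_ge0.
  by apply: ereal_sup_ubound; exists 1 => /=.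
apply: ge_ereal_sup => _ [d /= d0 <-]; apply/lee_addgt0Pr => e e0; rewrite add0e.
have k0 : 0 < (2 : R) `^ s by exact: powR_gt0.
(* The first bound keeps the sum of [(2 r)^s] below [e]; the second forces each single radius below
   [d / 2], so that the cover is fine enough for the premeasure. *)
pose c := Num.min (e / 2 `^ s) ((d / 2) `^ s).
have [|l [/allP l0 Al lc]] := Ac c.
  by rewrite lt_min !divr_gt0// powR_gt0// divr_gt0.
case: l l0 Al lc => [|p0 l'].
  move=> _ Al _; have -> : A = set0 by rewrite -subset0 => z /Al[p].
  apply: (@le_trans _ _ 0%E); last by rewrite lee_fin ltW.
  apply: ereal_inf_lbound; exists (fun=> set0).
    by split=> // i; apply: ge_ereal_sup => _ [y []].
  by apply: eseries0 => i _ _; rewrite /diam_pow asboolT.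
set l := p0 :: l' => l0 Al lc.
(* The finite list is continued by empty sets, to which [diam_pow] gives the value 0. *)
pose U i := if (i < size l)%N then [set z | mdist (nth p0 l i).1 z < (nth p0 l i).2] else set0.
have lr i : (i < size l)%N -> 0 < (nth p0 l i).2 /\ (nth p0 l i).2 < d / 2.
  move=> il; have pl := mem_nth p0 il; have r0 := l0 _ pl; split=> //.
  rewrite ltNge; apply/negP => /(ge0_ler_powR (ltW s0)).
  rewrite !nnegrE ltW ?divr_gt0// ltW// => /(_ isT isT); apply/negP; rewrite -ltNge.
  apply: (@lt_le_trans _ _ c); last by rewrite ge_min lexx orbT.
  apply: le_lt_trans lc; rewrite (big_nth p0) big_mkord.
  rewrite (bigD1 (Ordinal il))//= lerDl; apply: sumr_ge0 => *; exact: powR_ge0.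
apply: (@le_trans _ _ (\sum_(0 <= i <oo) diam_pow s (U i))%E).
  apply: ereal_inf_lbound; exists U => //; split.
    move=> z /Al[p pl pz]; exists (index p l) => //.
    by rewrite /U index_mem pl/= nth_index.
  move=> i; rewrite /U; case: ifP => [/lr[_ rd]|_]; last by apply: ge_ereal_sup => _ [y []].
  by rewrite (le_trans (ediam_ball _ _))// lee_fin (splitr d) lerD// ltW.
rewrite (nneseries_split _ (size l)); last by move=> *; exact: diam_pow_ge0.
rewrite add0n eseries0 ?adde0; last first.
  by move=> i li _; rewrite /U ltnNge li /diam_pow asboolT.
rewrite big_mkord; apply: (@le_trans _ _ (\sum_(i < size l) (2 `^ s * (nth p0 l i).2 `^ s)%:E)%E).
  apply: lee_sum => i _; have [r0 _] := lr i (ltn_ord i).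
  rewrite /diam_pow; case: ifPn => // _; first by rewrite lee_fin mulr_ge0// powR_ge0.
  rewrite -powRM ?(ltW r0)// -poweR_EFin; apply: (gt0_ler_poweR (ltW s0)).
  - rewrite in_itv/= leey andbT; apply: (@le_trans _ _ (mdist (nth p0 l i).1 (nth p0 l i).1)%:E).
      by rewrite mdistxx.
    by apply: mdist_le_ediam; rewrite /U ltn_ord/= mdistxx.
  - by rewrite in_itv/= leey lee_fin mulr_ge0// ltW.
  - by rewrite mulrDl !mul1r /U ltn_ord; exact: ediam_ball.
rewrite sumEFin lee_fin -mulr_sumr mulrC -ler_pdivlMr//.
rewrite -(big_mkord xpredT (fun i => (nth p0 l i).2 `^ s)) -(big_nth p0 xpredT (fun p => p.2 `^ s)).
by apply/ltW/(lt_le_trans lc); rewrite ge_min lexx.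
Qed.

Lemma dim_H_le s A : 0 < s -> (forall c, 0 < c -> content_lt s c A) ->
  (dim_H A <= s%:E)%E.
Proof.
move=> s0 Ac; rewrite /dim_H; case: ifP => _; first by rewrite lee_fin (le_trans _ (ltW s0))// lerN10.
by apply: ereal_inf_lbound; exists s => //; split; [exact: ltW|exact: content_lt_hausdorff_measure0].
Qed.

Lemma content_lt_of_dim_H s c A : compact A -> 0 < s -> 0 < c ->
  (dim_H A < s%:E)%E -> content_lt s c A.
Proof.
move=> cA s0 c0; rewrite /dim_H; case: asboolP => [-> _|_]; first exact: content_lt_set0.
move=> /ereal_inf_lt[_ [s' [s'0 As'] <-]]; rewrite lte_fin => /ltW s's.
exact: hausdorff_measure0_content_lt As'.
Qed.

Lemma dim_H_ge s c A : compact A -> 0 < s -> 0 < c -> ~ content_lt s c A ->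
  (s%:E <= dim_H A)%E.
Proof.
by move=> cA s0 c0 nA; rewrite leNgt; apply/negP => /(content_lt_of_dim_H cA s0 c0).
Qed.

Lemma dim_H_ge0 A : A !=set0 -> (0 <= dim_H A)%E.
Proof.
move=> /set0P/eqP A0; rewrite /dim_H asboolF//.
by apply: le_ereal_inf_tmp => _ [s [s0 _] <-].
Qed.

End ball_content.

(** * Uniform radii, and stability of small fibers under perturbation *)

Section robustness.
Context {R : realType} {K : metricType R}.
Implicit Types (x z : K) (A B E W : set K) (F G : nat -> K -> R).

(** Compactness in its near-covering form, with [d] tending to 0 from the right: what holds near
    each point for all small [d] holds everywhere for one [d]. *)
Lemma compact_uniform_radius A (P : R -> K -> Prop) : compact A ->
  (forall x, A x -> exists2 e, 0 < e &
    forall z d, A z -> mdist x z < e -> 0 < d -> d < e -> P d z) ->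
  exists2 d, 0 < d & forall z, A z -> P d z.
Proof.
move=> /compact_near_coveringP cA PA.
have : \forall d \near (0 : R)^'+, A `<=` (fun z => A z -> P d z).
  apply: cA => x /PA[e e0 xP].
  exists ([set z | mdist x z < e], [set d | 0 < d < e]) => /=.
    split; first exact: near_mdist.
    by near=> d; apply/andP; split.
  by move=> [z d] /= [xz /andP[d0 de]] Az; exact: xP.
move=> near0; near (0 : R)^'+ => d; exists d => //.
by move=> z Az; exact: (near near0 d).
Unshelve. all: by end_near. Qed.

Lemma continuous_mdistP (f : K -> R) : continuous f <->
  forall x e, 0 < e -> exists2 d, 0 < d & forall z, mdist x z < d -> `|f z - f x| < e.
Proof.
split=> [cf x e e0|cf x].
  have /near_mdistP[d d0 df] : \forall z \near x, `|f x - f z| < e.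
    by have /cvgrPdist_lt := cf x; exact.
  by exists d => // z /df/=; rewrite distrC.
apply/cvgrPdist_lt => e e0; have [d d0 df] := cf x e e0.
by apply/near_mdistP; exists d => // z /df; rewrite distrC.
Qed.

(** A map into R^n is a sequence of real functions of which only the first [n] matter, so that
    induction on [n] changes no type. *)
Definition fiber n F (y : nat -> R) : set K :=
  [set x | forall i, (i < n)%N -> F i x = y i].

Definition near_fiber n F (y : nat -> R) d : set K :=
  [set x | forall i, (i < n)%N -> `|F i x - y i| < d].

Definition thickening E (d : R) : set K := [set z | exists2 e, E e & mdist z e < d].

Lemma open_thickening E d : open (thickening E d).
Proof.
have -> : thickening E d = \bigcup_(e in E) [set z | mdist e z < d].
  by apply/seteqP; split=> z [e Ee ez]; exists e => //=; rewrite metric_sym.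
by apply: bigcup_open => e _; exact: open_mdist_lt.
Qed.

Lemma sub_thickening E d : 0 < d -> E `<=` thickening E d.
Proof. by move=> d0 z Ez; exists z => //; rewrite mdistxx. Qed.

(** A point outside [W] is off the closed set [E] or has a coordinate of [F] different from that of
    [y]. Either persists nearby, and compactness makes the margin uniform. *)
Lemma fiber_tube n F E W y : compact [set: K] -> closed E -> open W ->
  (forall i, continuous (F i)) -> E `&` fiber n F y `<=` W ->
  exists2 d, 0 < d & thickening E d `&` near_fiber n F y d `<=` W.
Proof.
move=> cK cE oW cF EW.
have [x _|d d0 Pd] := @compact_uniform_radius setT
    (fun d z => thickening E d z -> near_fiber n F y d z -> W z) cK; last first.
  by exists d => // z [/Pd]; apply.
have [Wx|nWx] := pselect (W x).
  have /near_mdistP[e e0 eW] : \forall z \near x, W z by apply: open_nbhs_nbhs.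
  by exists e => // z d _ /eW.
have [Ex|nEx] := pselect (E x); last first.
  have /near_mdistP[e e0 eE] : \forall z \near x, (~` E) z.
    by apply: open_nbhs_nbhs; split => //; exact: closed_openC.
  exists (e / 2); first by rewrite divr_gt0.
  move=> z d _ xz d0 de [a Ea za] _; suff /eE : mdist x a < e by [].
  by rewrite (le_lt_trans (metric_triangle x z a))// (splitr e) ltrD// (lt_trans za).
have [i [ilt Fx]] : exists i, (i < n)%N /\ F i x <> y i.
  apply: contrapT => nF; apply: nWx; apply: EW; split => // i ilt.
  by apply: contrapT => Fx; apply: nF; exists i.
have e0 : 0 < `|F i x - y i| / 2.
  by rewrite divr_gt0// normr_gt0 subr_eq0; apply/eqP.
have [d d0 dF] := (continuous_mdistP (F i)).1 (cF i) x _ e0.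
exists (Num.min d (`|F i x - y i| / 2)); first by rewrite lt_min d0.
move=> z d' _; rewrite lt_min => /andP[/dF Fzx _] _; rewrite lt_min => /andP[_ d'e] _ /(_ _ ilt) Fz.
suff : `|F i x - y i| < `|F i x - y i| by rewrite ltxx.
rewrite [X in _ < X]splitr -{1}(subrK (F i z) (F i x)) -addrA.
by rewrite (le_lt_trans (ler_normD _ _))// ltrD// ?(lt_trans Fz)// distrC.
Qed.

(** The values [y] do not form a compact set, but a value with a nonempty near fiber is close to the
    value of [F] at some point [z0]. Uniformity over the points of [K] therefore suffices, at the
    price of halving [d]. *)
Lemma content_lt_thickening n F E s c : compact [set: K] -> closed E -> 0 < c ->
  (forall i, continuous (F i)) -> (forall y, content_lt s c (E `&` fiber n F y)) ->
  exists2 d, 0 < d & forall y, content_lt s c (thickening E d `&` near_fiber n F y d).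
Proof.
move=> cK cE c0 cF Ec.
have [x _|d d0 Pd] := @compact_uniform_radius setT
    (fun d z => content_lt s c (thickening E d `&` near_fiber n F (F ^~ z) d)) cK; last first.
  exists (d / 2); first by rewrite divr_gt0.
  move=> y; set S := thickening _ _ `&` _.
  have [->|/set0P[z0 [_ z0y]]] := eqVneq S set0; first exact: content_lt_set0.
  apply: content_ltS (Pd z0 I) => z [[e Ee ze] zy]; split.
    by exists e => //; rewrite (lt_le_trans ze)// ler_pdivrMr// ler_pMr// ler1n.
  move=> i ilt; rewrite -(subrK (y i) (F i z)) -addrA (splitr d).
  by rewrite (le_lt_trans (ler_normD _ _))// ltrD ?zy// distrC z0y.
have [W [oW EW Wc]] := content_lt_open (Ec (F ^~ x)).
have [d d0 dW] := fiber_tube cK cE oW cF EW.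
have d20 : 0 < d / 2 by rewrite divr_gt0.
have [e e0 eF] : exists2 e, 0 < e & forall z, mdist x z < e ->
    forall i, (i < n)%N -> `|F i z - F i x| < d / 2.
  elim: (n) => [|m [e e0 eF]]; first by exists 1.
  have [e' e'0 eF'] := (continuous_mdistP (F m)).1 (cF m) x _ d20.
  exists (Num.min e e'); first by rewrite lt_min e0.
  move=> z; rewrite lt_min => /andP[/eF zF /eF' zF'] i; rewrite ltnS leq_eqVlt.
  by move=> /orP[/eqP ->|/zF].
exists (Num.min e (d / 2)); first by rewrite lt_min e0.
move=> z d' _; rewrite !lt_min => /andP[/eF xz _] _ /andP[_ d'd].
apply: content_ltS Wc => w [[a Ea wa] wF]; apply: dW; split.
  by exists a => //; rewrite (lt_trans wa)// (lt_le_trans d'd)// ler_pdivrMr// ler_pMr// ler1n.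
move=> i ilt; rewrite -(subrK (F i z) (F i w)) -addrA (splitr d).
by rewrite (le_lt_trans (ler_normD _ _))// ltrD ?xz// (lt_trans (wF _ ilt)).
Qed.

(* The condition on [G] is open, by [content_lt_thickening]: this is what makes it survive
   the further perturbations made in the inductions below. *)
Definition small_fibers_dense n s E := forall F (e c : R),
  (forall i, continuous (F i)) -> 0 < e -> 0 < c ->
  exists G, [/\ forall i, continuous (G i), forall i x, `|G i x - F i x| < e &
    forall y, content_lt s c (E `&` fiber n G y)].

Lemma small_fibers_denseU n s A B : compact [set: K] -> closed A ->
  small_fibers_dense n s A -> small_fibers_dense n s B ->
  small_fibers_dense n s (A `|` B).
Proof.
move=> cK cA dA dB F e c cF e0 c0.
have e20 : 0 < e / 2 by rewrite divr_gt0.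
have c20 : 0 < c / 2 by rewrite divr_gt0.
have [G [cG GF Gc]] := dA F _ _ cF e20 c20.
have [d d0 dG] := content_lt_thickening cK cA c20 cG Gc.
(* The perturbation made for [B] stays below the margin [d] within which the fibers on [A] remain
   small. *)
have [|H [cH HG Hc]] := dB G (Num.min d (e / 2)) _ cG _ c20.
  by rewrite lt_min d0.
exists H; split=> // [i x|y].
  rewrite -(subrK (G i x) (H i x)) -addrA (splitr e).
  rewrite (le_lt_trans (ler_normD _ _))// ltrD//.
  by apply: (lt_le_trans (HG i x)); rewrite ge_min lexx orbT.
rewrite setIUl (splitr c); apply: content_ltU (Hc y).
apply: content_ltS (dG y) => z [Az zy]; split; first exact: sub_thickening.
move=> i ilt; rewrite -(zy _ ilt) distrC.
by apply: (lt_le_trans (HG i z)); rewrite ge_min lexx.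
Qed.

End robustness.

(** * Relative boundaries as subsets of the ambient space *)

Section relative_boundary.
Context {T : topologicalType}.
Implicit Types A W : set T.

(** For open [W], this is the boundary, in the subspace [A], of the trace of [W] on [A]. *)
Definition rel_boundary A W : set T := A `&` closure (A `&` W) `&` ~` W.

Lemma boundary_in_preimage A W : open W ->
  boundary_in (set_val @^-1` W : set A) = rel_boundary A W.
Proof.
move=> oW; have oU : open (set_val @^-1` W : set A) by exists W.
apply/seteqP; split=> [_ [z [clz nz] <-]|x [[Ax clx] nWx]].
  split; last by move: nz; rewrite (iffLR (interior_id _) oU).
  split; first exact: (set_mem (valP z)).
  move=> V Vz; have : nbhs z (set_val @^-1` V : set A) by exact: initial_continuous.
  move=> /clz[w [Ww Vw]]; exists (set_val w); split=> //; split=> //.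
  exact: (set_mem (valP w)).
exists (SigSub (mem_set Ax)) => //; split; last first.
  by rewrite (iffLR (interior_id _) oU).
move=> N; rewrite nbhsE => -[_ [[V oV <-] Vx] VN].
have : nbhs x V by apply: open_nbhs_nbhs.
move=> /clx[w [[Aw Ww] Vw]]; exists (SigSub (mem_set Aw)); split=> //.
exact: VN.
Qed.

Lemma closed_rel_boundary A W : closed A -> open W -> closed (rel_boundary A W).
Proof.
move=> cA oW; apply: closedI; last exact: open_closedC.
by apply: closedI => //; exact: closed_closure.
Qed.

End relative_boundary.

(** * Inductive dimensions through open sets of the ambient space *)

Section inductive_dimension.
Context {R : realType} {K : metricType R}.
Implicit Types (x z : K) (A W : set K).

Lemma dim_tHS_lt n A (d : R) : (dim_tH n.+1 A < d%:E)%E ->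
  forall x (e : R), A x -> 0 < e -> exists W, [/\ open W, W x,
    A `&` W `<=` [set z | mdist x z < e] &
    (dim_tH n (rel_boundary A W) < (d - 1)%:E)%E].
Proof.
move=> /= + x e Ax e0; rewrite asboolF; last by move=> A0; rewrite A0 in Ax.
move=> /ereal_inf_lt[d' [B [Bo Bb] Bd] d'd].
pose x' : A := SigSub (mem_set Ax).
have : nbhs x' (set_val @^-1` [set z | mdist x z < e] : set A).
  by apply: initial_continuous => /=; exact: near_mdist.
move=> /(Bb x')[U [BU Ux] Ue]; have [W oW WU] := Bo _ BU.
exists W; split=> //; first by move: Ux; rewrite -WU.
  move=> z [Az Wz]; apply: (Ue (SigSub (mem_set Az))).
  by rewrite /= -WU.
rewrite -boundary_in_preimage// WU.
apply: le_lt_trans (Bd _ BU) _ => {Bd}.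
by case: d' d'd => [r| |]//=; rewrite -?EFinD ?lte_fin ?ltrD2r// ?ltNyr.
Qed.

(** The basis consists of all relatively open sets whose boundary is small enough. The bound
    [-1 <= d] settles the empty set. *)
Lemma dim_tHS_le n A (d : R) : -1 <= d ->
  (forall x (e : R), A x -> 0 < e -> exists W, [/\ open W, W x,
    A `&` W `<=` [set z | mdist x z < e] &
    (dim_tH n (rel_boundary A W) <= (d - 1)%:E)%E]) ->
  (dim_tH n.+1 A <= d%:E)%E.
Proof.
move=> d0 Ad /=; case: ifP => _; first by rewrite lee_fin.
apply: ereal_inf_lbound.
exists [set U : set A | open U /\ (dim_tH n (boundary_in U) <= d%:E - 1)%E]; last by move=> U [].
split=> [U []//|x N]; rewrite nbhsE => -[_ [[V oV <-] Vx] VN].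
have /near_mdistP[e e0 eV] : nbhs (set_val x) V by apply: open_nbhs_nbhs.
have [W [oW Wx We Wd]] := Ad (set_val x) e (set_mem (valP x)) e0.
exists (set_val @^-1` W); last first.
  move=> z Wz; apply: VN; apply: eV; apply: We; split => //.
  exact: (set_mem (valP z)).
split=> //; split; first by exists W.
by rewrite boundary_in_preimage// -EFinB.
Qed.

(** A negative Hausdorff dimension forces emptiness, and above level 0 both dimensions follow the
    same recursion. This is how the hypothesis on [dim_t] bounds [dim_tH] from below. *)
Lemma dim_tH_small_ind n A : (dim_tH n A < (n%:R : R)%:E)%E -> small_ind_lt n A.
Proof.
elim: n A => [|n IH] A.
  rewrite /= /dim_H; case: asboolP => // /eqP/set0P A0.
  by rewrite ltNge le_ereal_inf_tmp// => _ [s [s0 _] <-]; rewrite lee_fin.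
rewrite /=; case: asboolP => [-> _|_].
  exists [set U | open U]; last first.
    move=> U _; rewrite boundary_in0; apply: (@small_ind_lt_leq _ 0%N) => //.
  by split=> // x; have := set_mem (valP x); by [].
move=> /ereal_inf_lt[d [B Bb Bd] dn]; exists B => // U BU; apply: IH.
apply: le_lt_trans (Bd _ BU) _ => {Bd}.
by case: d dn => [r| |]//=; rewrite -?EFinD ?lte_fin ?ltrBlDr ?natr1// ?ltNyr.
Qed.

End inductive_dimension.

(** * Finite subcovers, distinct nearby values, and extension of functions *)

Section extension.
Context {R : realType} {K : metricType R}.
Implicit Types (x z : K) (A : set K).

Lemma finite_subcover A (W : K -> set K) : compact A ->
  (forall x, A x -> open (W x)) -> (forall x, A x -> W x x) ->
  exists l : seq K, (forall x, x \in l -> A x) /\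
    (forall z, A z -> exists2 x, x \in l & W x z).
Proof.
move=> /compact_near_coveringP cA oW Wx.
pose inA := [set l : seq K | forall x, x \in l -> A x].
(* Finite lists of points of [A], directed by inclusion, form the filter to which near covering is
   applied. *)
pose F := filter_from inA (fun l => [set l' | inA l' /\ {subset l <= l'}]).
have FF : Filter F.
  apply: filter_from_filter; first by exists [::].
  move=> l l' lA l'A; exists (l ++ l').
    by move=> x; rewrite mem_cat => /orP[/lA|/l'A].
  by move=> k [kA lk]; split; split=> // x xl; apply: lk; rewrite mem_cat xl ?orbT.
have [|l lA lP] := cA _ F (fun l z => exists2 x, x \in l & W x z) FF.
  move=> x Ax; exists (W x, [set l : seq K | x \in l]).
    split; first by apply: open_nbhs_nbhs; split; [exact: oW|exact: Wx].
    exists [:: x] => [y|l [_]]; first by rewrite inE => /eqP ->.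
    by apply; exact: mem_head.
  by move=> [z l] /= [Wz xl]; exists x.
exists l; split=> //; exact: lP (conj lA (fun x xl => xl)).
Qed.

Lemma exists_injective_near (b : nat -> R) (e : R) m : 0 < e ->
  exists a : nat -> R, (forall j, `|a j - b j| < e) /\
    (forall i j, (i < m)%N -> (j < m)%N -> a i = a j -> i = j).
Proof.
move=> e0; elim: m => [|m [a [ab ainj]]].
  by exists b; split=> // j; rewrite subrr normr0.
(* Among [m.+1] such candidates one avoids the [m] values already chosen; [k.+2] rather than [k.+1]
   keeps the shift strictly below [e]. *)
pose t k : R := b m + e / k.+2%:R.
have t_inj : injective t.
  move=> i j /addrI/(mulfI (lt0r_neq0 e0))/invr_inj/eqP.
  by rewrite eqr_nat => /eqP[].
have [k tk] : exists k, t k \notin [seq a i | i <- iota 0 m].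
  apply: contrapT => nt.
  have : {subset [seq t k | k <- iota 0 m.+1] <= [seq a i | i <- iota 0 m]}.
    by move=> _ /mapP[k _ ->]; apply: contrapT => /negP tk; apply: nt; exists k.
  move=> /uniq_leq_size; rewrite map_inj_uniq// iota_uniq !size_map !size_iota.
  by move=> /(_ isT); rewrite ltnn.
have am i : (i < m)%N -> a i != t k.
  move=> im; apply: contraNneq tk => <-; apply/mapP; exists i => //.
  by rewrite mem_iota.
exists (fun j => if j == m then t k else a j); split=> [j|i j].
  case: eqVneq => [->|//]; rewrite /t addrC addKr gtr0_norm ?divr_gt0//.
  by rewrite ltr_pdivrMr// ltr_pMr// ltr1n.
have lt_neq i' : (i' < m.+1)%N -> i' != m -> (i' < m)%N by rewrite ltnS ltn_neqAle => -> ->.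
move=> /lt_neq im /lt_neq jm.
case: eqVneq im => [-> _|_ /(_ isT) im]; case: eqVneq jm => [-> _|_ /(_ isT) jm]//.
- by move/esym/eqP; rewrite (negPf (am _ jm)).
- by move/eqP; rewrite (negPf (am _ im)).
- exact: ainj.
Qed.

Lemma within_continuous_paste m (C : nat -> set K) (u : nat -> K -> R) :
  (forall j, (j < m)%N -> closed (C j)) ->
  (forall i j x, (i < j)%N -> (j < m)%N -> C i x -> ~ C j x) ->
  (forall j, (j < m)%N -> {within C j, continuous (u j)}) ->
  exists h : K -> R,
    {within [set x | exists2 j, (j < m)%N & C j x], continuous h} /\
    (forall j x, (j < m)%N -> C j x -> h x = u j x).
Proof.
elim: m => [|m IH] cC dC cu.
  exists (fun=> 0); split=> //.
  rewrite (_ : [set x | _] = set0); first exact: continuous_subspace0.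
  by rewrite -subset0 => x [].
have [j jm|i j x ij jm|j jm|h [ch hu]] := IH.
- by apply: cC; exact: ltnW.
- by apply: dC => //; exact: ltnW.
- by apply: cu; exact: ltnW.
exists (fun x => if `[< C m x >] then u m x else h x); split; last first.
  move=> j x; rewrite ltnS leq_eqVlt => /orP[/eqP -> Cx|jm Cx]; first by rewrite asboolT.
  by rewrite asboolF ?(hu j)//; exact: dC Cx.
rewrite (_ : [set x | _] = [set x | exists2 j, (j < m)%N & C j x] `|` C m); last first.
  apply/seteqP; split=> [x [j]|x [[j jm Cx]|Cx]].
  - by rewrite ltnS leq_eqVlt => /orP[/eqP -> |jm Cx]; [right|left; exists j].
  - by exists j => //; exact: ltnW.
  - by exists m.
apply: withinU_continuous.
- rewrite (_ : [set x | _] = \bigcup_(j in `I_m) C j) //.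
  apply: closed_bigcup; first exact: finite_II.
  by move=> j /= jm; apply: cC; exact: ltnW.
- exact: cC.
- apply: subspace_eq_continuous ch => x /set_mem[j jm Cx].
  by rewrite /from_subspace asboolF//; exact: dC Cx.
- apply: subspace_eq_continuous (cu m (ltnSn m)) => x /set_mem Cx.
  by rewrite /from_subspace asboolT.
Qed.

(** Functions on disjoint closed pieces paste to a continuous function on their union, and Tietze's
    theorem extends it with the same bound. *)
Lemma paste_extension m (C : nat -> set K) (u : nat -> K -> R) M :
  compact [set: K] -> 0 < M ->
  (forall j, (j < m)%N -> closed (C j)) ->
  (forall i j x, (i < j)%N -> (j < m)%N -> C i x -> ~ C j x) ->
  (forall j, (j < m)%N -> {within C j, continuous (u j)}) ->
  (forall j x, (j < m)%N -> C j x -> `|u j x| <= M) ->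
  exists g : K -> R, [/\ continuous g, forall x, `|g x| <= M &
    forall j x, (j < m)%N -> C j x -> g x = u j x].
Proof.
move=> cK M0 cC dC cu uM.
have [h [ch hu]] := within_continuous_paste cC dC cu.
have nK : normal_space K by apply: compact_normal => //; exact: metric_hausdorff.
have clC : closed [set x | exists2 j, (j < m)%N & C j x].
  rewrite (_ : [set x | _] = \bigcup_(j in `I_m) C j) //.
  by apply: closed_bigcup; [exact: finite_II|exact: cC].
have [|g [hg cg gM]] := continuous_bounded_extension nK clC M0 ch.
  by move=> x [j jm Cx]; rewrite (hu j) ?uM.
exists g; split=> // j x jm Cx; rewrite -hg ?(hu j)//.
by apply/mem_set; exists j.
Qed.

End extension.

(** * Density of maps with small fibers *)

Section upper_bound.
Context {R : realType} {K : metricType R}.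
Implicit Types (x z : K) (A : set K) (F G : nat -> K -> R).

Lemma small_fibers_dense_set0 n s : small_fibers_dense n s (set0 : set K).
Proof.
move=> F e c cF e0 c0; exists F; split=> // [i x|y].
  by rewrite subrr normr0.
by rewrite set0I; exact: content_lt_set0.
Qed.

Lemma small_fibers_dense_bigU n s (l : seq K) (E : K -> set K) : compact [set: K] ->
  (forall x, x \in l -> closed (E x) /\ small_fibers_dense n s (E x)) ->
  let U := [set z | exists2 x, x \in l & E x z] in
  closed U /\ small_fibers_dense n s U.
Proof.
move=> cK; elim: l => [|x l IH] lE U.
  have -> : U = set0 by rewrite -subset0 => z [].
  by split; [exact: closed0|exact: small_fibers_dense_set0].
have [|cU dU] := IH; first by move=> z zl; apply: lE; rewrite inE zl orbT.
have [cE dE] := lE x (mem_head _ _).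
have -> : U = E x `|` [set z | exists2 x, x \in l & E x z].
  apply/seteqP; split=> [z [w]|z [Ez|[w wl Ew]]].
  - by rewrite inE => /orP[/eqP ->|wl Ew]; [left|right; exists w].
  - by exists x => //; exact: mem_head.
  - by exists w => //; rewrite inE wl orbT.
by split; [exact: closedU|exact: small_fibers_denseU].
Qed.

Lemma exists_powR_lt (s c : R) : 0 < s -> 0 < c -> exists2 r, 0 < r & r `^ s < c.
Proof.
move=> s0 c0; exists ((c / 2) `^ s^-1); first by rewrite powR_gt0// divr_gt0.
rewrite -powRrM mulVf ?gt_eqF// powRr1 ?divr_ge0 ?ltW//.
by rewrite ltr_pdivrMr// ltr_pMr// ltr1n.
Qed.

Lemma small_fibers_dense_step n s A : compact [set: K] -> 0 < s -> closed A ->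
  (forall x (e : R), A x -> 0 < e -> exists W, [/\ open W, W x,
    A `&` W `<=` [set z | mdist x z < e] & small_fibers_dense n s (rel_boundary A W)]) ->
  small_fibers_dense n.+1 s A.
Proof.
move=> cK s0 cA AW F e c cF e0 c0.
have c20 : 0 < c / 2 by rewrite divr_gt0.
have e20 : 0 < e / 2 by rewrite divr_gt0.
have e40 : 0 < e / 2 / 2 by rewrite divr_gt0.
have [r r0 rc] := exists_powR_lt s0 c20.
(* Each trace lies in one ball of cost less than [c / 2], and [F n] oscillates there by less than
   [e / 4], so that replacing [F n] by a constant is a small change. *)
have /choice[W WP] : forall x, exists W : set K, A x -> [/\ open W, W x,
    A `&` W `<=` [set z | mdist x z < r /\ `|F n z - F n x| < e / 2 / 2] &
    small_fibers_dense n s (rel_boundary A W)].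
  move=> x; have [Ax|nAx] := pselect (A x); last by exists set0.
  have [d d0 dF] := (continuous_mdistP (F n)).1 (cF n) x _ e40.
  have [|W [oW Wx Wd dW]] := AW x (Num.min d r) Ax; first by rewrite lt_min d0.
  exists W => _; split=> // z /Wd /=; rewrite lt_min => /andP[xd xr].
  by split=> //; exact: dF.
have [|||l [lA lc]] := @finite_subcover _ _ A W.
- by apply: (subclosed_compact cA cK).
- by move=> x /WP[].
- by move=> x /WP[].
have [|cE dE] := @small_fibers_dense_bigU n s l (rel_boundary A \o W) cK.
  move=> x /lA /WP[oW _ _ dW]; split=> //; exact: closed_rel_boundary.
set E := [set z | _] in cE dE.
have [G [cG GF Gc]] := dE F _ _ cF e0 c20.
have [d d0 dG] := content_lt_thickening cK cE c20 cG Gc.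
have [lnil|[x0 _]] : l = [::] \/ exists x0 : K, True.
  by case: (l) => [|x0 ?]; [left|right; exists x0].
  exists G; split=> // y; apply: content_ltS (content_lt_set0 _ c0).
  by move=> z [/lc[x]]; rewrite lnil.
pose p j := nth x0 l j.
have pl j : (j < size l)%N -> p j \in l by exact: mem_nth.
have oWp j : (j < size l)%N -> open (W (p j)) by move=> /pl /lA /WP[].
(* Away from the boundaries collected in [E], the closure of a trace adds no point to it. Hence
   [D j] is closed and yet contained in [W (p j)], and removing the earlier open sets makes the
   pieces disjoint. *)
pose D j := A `&` ~` thickening E d `&` closure (A `&` W (p j)) `&`
  ~` (\bigcup_(i in `I_j) W (p i)).
have DW j z : (j < size l)%N -> D j z -> W (p j) z.
  move=> jl [[[Az nz] clz] _]; apply: contrapT => nW; apply: nz.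
  by apply: sub_thickening => //; exists (p j); rewrite ?pl.
have DF j z : (j < size l)%N -> D j z ->
    mdist (p j) z < r /\ `|F n z - F n (p j)| < e / 2 / 2.
  move=> jl Dz; have [_ _ Wd _] := WP _ (lA _ (pl _ jl)).
  by apply: Wd; split; [case: Dz => [[[]]]|exact: DW].
have cD j : (j < size l)%N -> closed (D j).
  move=> jl; apply: closedI; last first.
    apply: open_closedC; apply: bigcup_open => i /= ij.
    exact/oWp/(ltn_trans ij).
  apply: closedI; last exact: closed_closure.
  by apply: closedI => //; apply: open_closedC; exact: open_thickening.
have dD i j z : (i < j)%N -> (j < size l)%N -> D i z -> ~ D j z.
  move=> ij jl Diz [_]; apply; exists i => //.
  by apply: DW => //; exact: ltn_trans jl.
have [a [ab ainj]] := exists_injective_near (fun j => F n (p j)) (size l) e40.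
(* Adding [g] to [F n] gives the constant [a j] on [D j]. The bound [e / 2] adds the oscillation of
   [F n] to the distance from [a j] to [F n (p j)]. *)
have [||g [cg ge gD]] := @paste_extension _ _ (size l) D (fun j z => a j - F n z) (e / 2) cK e20 cD dD.
- move=> j jl; apply: continuous_subspaceT => z.
  by apply: continuousB; [exact: cst_continuous|exact: cF].
- move=> j z jl /(DF _ _ jl)[_ Fz].
  rewrite -(subrKA (F n (p j))) (le_trans (ler_normD _ _))//.
  by rewrite (splitr (e / 2)) lerD// ltW// distrC.
exists (fun i => if i == n then F n \+ g else G i); split.
- move=> i; case: eqP => // _ z; apply: continuousD; [exact: cF|exact: cg].
- move=> i z; case: eqP => [->|//] /=; rewrite addrC addKr.
  by rewrite (le_lt_trans (ge z))// ltr_pdivrMr// ltr_pMr// ltr1n.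
move=> y; rewrite (splitr c).
set S := [set z | A z /\ ~ thickening E d z /\ F n z + g z = y n].
suff Sc : content_lt s (c / 2) S.
  apply: content_ltS (content_ltU (dG y) Sc) => z [Az zy].
  have [tz|ntz] := pselect (thickening E d z).
    left; split=> // i ilt; have := zy i (ltnW ilt).
    by rewrite ltn_eqF// => ->; rewrite subrr normr0.
  by right; split => //; split => //; have := zy n (ltnSn n); rewrite eqxx.
have SD z : S z -> exists2 j, (j < size l)%N & D j z.
  (* The least index whose open set contains [z] yields the piece containing [z]. *)
  move=> [Az [ntz _]]; have ex : exists j, (j < size l)%N && `[< W (p j) z >].
    have [x xl Wz] := lc z Az; exists (index x l).
    by rewrite index_mem xl /p nth_index//; exact/asboolP.
  case: (ex_minnP ex) => j /andP[jl /asboolP Wz] jmin; exists j => //.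
  split; first by split => //; apply: subset_closure.
  move=> [i /= ij Wi]; have := jmin i.
  by rewrite (ltn_trans ij)//= asboolT// leqNgt ij => /(_ isT).
have [->|/set0P[z0 Sz0]] := eqVneq S set0; first exact: content_lt_set0.
have [j jl Dz0] := SD _ Sz0.
(* Since the constants [a j] are distinct, the value [y n] selects a single piece, which lies in one
   ball of radius [r]. *)
apply: content_ltS (content_lt_ball (p j) r0 rc) => z Sz /=.
have [j' jl' Dz] := SD _ Sz.
have aE i w : (i < size l)%N -> S w -> D i w -> a i = y n.
  by move=> il [_ [_ <-]] /(gD _ _ il) ->; rewrite addrC subrK.
have -> : j = j' by apply: ainj => //; rewrite (aE _ z0)// (aE _ z).
exact: (DF _ _ jl' Dz).1.
Qed.

Lemma small_fibers_dense_dim_tH n s A : compact [set: K] -> 0 < s -> closed A ->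
  (dim_tH n A < (s + n%:R)%:E)%E -> small_fibers_dense n s A.
Proof.
move=> cK s0; elim: n A => [|n IH] A cA dA.
  move=> F e c cF e0 c0; exists F; split=> // [i x|y].
    by rewrite subrr normr0.
  apply: (@content_ltS _ _ _ _ _ A); first exact: subIsetl.
  apply: content_lt_of_dim_H => //; first exact: (subclosed_compact cA cK).
  by move: dA; rewrite addr0 /= /dim_H; case: asboolP.
apply: small_fibers_dense_step => // x e Ax e0.
have [W [oW Wx We Wd]] := dim_tHS_lt dA Ax e0.
exists W; split=> //; apply: IH; first exact: closed_rel_boundary.
by move: Wd; rewrite -natr1 addrA addrK.
Qed.

End upper_bound.

(** * Separability and Baire category for continuous functions *)

Section function_spaces.
Context {R : realType} {K : metricType R}.
Hypothesis cK : compact [set: K].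
Implicit Types (x z : K) (f g h : K -> R).

Lemma exists_invn_lt (e : R) : 0 < e -> exists k, k.+1%:R^-1 < e.
Proof.
move=> e0; have e10 : 0 <= e^-1 by rewrite invr_ge0 ltW.
exists (Num.truncn e^-1); rewrite invf_plt ?posrE//.
exact: truncnS_gt.
Qed.

Lemma uniformly_continuous_mdist f : continuous f ->
  forall e, 0 < e -> exists2 d, 0 < d & forall x z, mdist x z < d -> `|f z - f x| < e.
Proof.
move=> /continuous_mdistP cf e e0.
have [x _|d d0 Pd] := @compact_uniform_radius _ _ setT
    (fun d x => forall z, mdist x z < d -> `|f z - f x| < e) cK; last first.
  by exists d => // x z; exact: Pd.
have [|d d0 df] := cf x (e / 2); first by rewrite divr_gt0.
exists (d / 2); first by rewrite divr_gt0.
move=> z r _ xz _ rd w zw.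
have dd : d / 2 < d by rewrite ltr_pdivrMr// ltr_pMr// ltr1n.
rewrite -(subrKA (f x)) (le_lt_trans (ler_normD _ _))// (splitr e) ltrD//.
  apply: df; rewrite (le_lt_trans (metric_triangle x z w))// (splitr d) ltrD//.
  exact: lt_trans rd.
by rewrite distrC; apply: df; exact: lt_trans dd.
Qed.

(* A continuous function is determined up to [1/(k+1)] by rational approximations
   of its values on a finite net that is fine enough for its modulus of
   continuity; the family picks one function for each such pattern. *)
Lemma separable_continuous : exists D : nat -> K -> R,
  (forall k, continuous (D k)) /\
  forall f (e : R), continuous f -> 0 < e -> exists k, forall x, `|D k x - f x| < e.
Proof.
have /choice[net netP] : forall m : nat, exists l : seq K,
    forall z, exists2 x, x \in l & mdist x z < m.+1%:R^-1.
  move=> m; have [||l [_ lP]] := @finite_subcover _ _ setT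
      (fun x => [set z | mdist x z < m.+1%:R^-1]) cK.
  - by move=> x _; exact: open_mdist_lt.
  - by move=> x _ /=; rewrite mdistxx.
  - by exists l => z; exact: lP.
(* In a pattern [t], [t.1.1] selects the net, [t.1.2] the precision, and [t.2] lists the rational
   values in the order of the net. *)
pose pat (t : nat * nat * seq rat) (f : K -> R) := [/\ continuous f,
  forall x, x \in net t.1.1 ->
    `|f x - ratr (nth 0 t.2 (index x (net t.1.1)))| < t.1.2.+1%:R^-1 &
  forall x z, x \in net t.1.1 -> mdist x z < t.1.1.+1%:R^-1 ->
    `|f z - f x| < t.1.2.+1%:R^-1].
have /choice[D DP] : forall j : nat, exists f, continuous f /\
    forall t, unpickle j = Some t -> (exists g, pat t g) -> pat t f.
  move=> j; case: (unpickle j) => [t|]; last first.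
    by exists (fun=> 0); split => // x; exact: cst_continuous.
  have [[g gt]|ng] := pselect (exists g, pat t g).
    by exists g; split=> [|_ [<-]//]; case: gt.
  exists (fun=> 0); split => [x|_ [<-]//]; exact: cst_continuous.
exists D; split=> [k|f e cf e0]; first by have [] := DP k.
(* Four errors add up: from [z] to a net point for each of the two functions, and from each function
   to the common rational value there. *)
have e40 : 0 < e / 2 / 2 by rewrite !divr_gt0.
have [k ke] := exists_invn_lt e40.
have k0 : 0 < k.+1%:R^-1 :> R by rewrite invr_gt0.
have [d d0 df] := uniformly_continuous_mdist cf k0.
have [m md] := exists_invn_lt d0.
have /choice[q qP] : forall x, exists q : rat, `|f x - ratr q| < k.+1%:R^-1.
  move=> x; have [|q] := @rat_in_itvoo R (f x) (f x + k.+1%:R^-1); first by rewrite ltrDl.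
  rewrite in_itv/= => /andP[xq qx]; exists q.
  move: xq qx; set r : R := ratr q; set w : R := k.+1%:R^-1 => xq qx.
  by rewrite ltr_norml; apply/andP; split; lra.
pose t := (m, k, [seq q x | x <- net m]).
have ft : pat t f.
  split=> //= [x xl|x z _ xz]; last by apply: df; exact: lt_trans md.
  by rewrite (nth_map x) ?index_mem// nth_index.
exists (pickle t) => z; have [_ /(_ t)] := DP (pickle t).
rewrite pickleK => /(_ erefl)[]; first by exists f.
set g := D _; move=> cg gl gz; have [x xl xz] := netP m z.
have [_ fl fz] := ft.
move: (gl _ xl) (gz _ _ xl xz) (fl _ xl) (fz _ _ xl xz) => /=.
rewrite !ltr_norml; set r := ratr _; set w := _^-1 in ke *.
by move=> /andP[? ?] /andP[? ?] /andP[? ?] /andP[? ?]; apply/andP; split; lra.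
Qed.

(** The Baire category theorem by nested closed balls, kept as pairs of a center and a radius; the
    hypothesis says that each [O k] has dense interior among continuous functions. *)
Lemma baire_continuous (O : nat -> set (K -> R)) f (e : R) : continuous f -> 0 < e ->
  (forall k g r, continuous g -> 0 < r -> exists h, [/\ continuous h,
    forall x, `|h x - g x| < r & exists2 d, 0 < d &
    forall h', continuous h' -> (forall x, `|h' x - h x| <= d) -> O k h']) ->
  exists h, [/\ continuous h, forall x, `|h x - f x| <= e & forall k, O k h].
Proof.
move=> cf e0 Od.
pose good (p : (K -> R) * R) := continuous p.1 /\ 0 < p.2.
have /choice[step stepP] : forall kp : nat * ((K -> R) * R), exists p', good kp.2 ->
    [/\ good p', p'.2 <= kp.2.2 / 2, forall x, `|p'.1 x - kp.2.1 x| + p'.2 <= kp.2.2 &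
    forall h', continuous h' -> (forall x, `|h' x - p'.1 x| <= p'.2) -> O kp.1 h'].
  move=> [k [g r]] /=; have [[cg r0]|] := pselect (good (g, r)); last by exists (g, r).
  have r20 : 0 < r / 2 by rewrite divr_gt0.
  have [h [ch gh [d d0 dO]]] := Od k g _ cg r20.
  exists (h, Num.min d (r / 2)) => _; split=> /=.
  - by split=> //=; rewrite lt_min d0.
  - by rewrite ge_min lexx orbT.
  - move=> x; rewrite [leRHS](splitr r); apply: lerD; first exact/ltW/gh.
    by rewrite ge_min lexx orbT.
  - move=> h' ch' hh'; apply: dO => // x; rewrite (le_trans (hh' x))//.
    by rewrite ge_min lexx.
pose P := fix P k := if k is k'.+1 then step (k', P k') else (f, e).
have gP k : good (P k) by elim: k => //= k IH; have [] := stepP (k, P k) IH.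
have PS k x : `|(P k.+1).1 x - (P k).1 x| + (P k.+1).2 <= (P k).2.
  by have [_ _ /(_ x)] := stepP (k, P k) (gP k).
have Pe k : (P k).2 <= e / 2 ^+ k.
  elim: k => [|k IH]; first by rewrite expr0 divr1.
  have [_ /= h _ _] := stepP (k, P k) (gP k); apply: (le_trans h).
  by rewrite exprSr invfM mulrA ler_pM2r// invr_gt0.
have Pjk j k x : (k <= j)%N -> `|(P j).1 x - (P k).1 x| + (P j).2 <= (P k).2.
  move=> /subnK <-; elim: (j - k)%N => [|i IH].
    by rewrite add0n subrr normr0 add0r.
  apply: le_trans IH; rewrite addSn; set m := (i + k)%N.
  have := PS m x; have := ler_normD ((P m.+1).1 x - (P m).1 x) ((P m).1 x - (P k).1 x).
  by rewrite subrKA; lra.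
have ab j k x : (P j).1 x - (P j).2 <= (P k).1 x + (P k).2.
  have [_ j0] := gP j; have [_ k0] := gP k.
  by case: (leqP k j) => [kj|/ltnW jk];
    [have := Pjk _ _ x kj|have := Pjk _ _ x jk]; move=> H;
    have := ler_norm ((P j).1 x - (P k).1 x);
    have := ler_norm ((P k).1 x - (P j).1 x); move: H;
    rewrite (distrC ((P k).1 x)); lra.
(* The intervals of center [(P j).1 x] and radius [(P j).2] meet pairwise by [ab], so the supremum
   of their left ends lies in all of them. *)
pose h x := sup [set (P j).1 x - (P j).2 | j in [set: nat]].
have hub x : has_ubound [set (P j).1 x - (P j).2 | j in [set: nat]].
  by exists ((P 0%N).1 x + (P 0%N).2) => _ [j _ <-]; exact: ab.
have hP k x : `|h x - (P k).1 x| <= (P k).2.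
  rewrite ler_norml; apply/andP; split.
    by rewrite lerBrDr addrC; apply: ub_le_sup => //; exists k.
  rewrite lerBlDr addrC; apply: ge_sup => [|_ [j _ <-]]; last exact: ab.
  by exists ((P 0%N).1 x - (P 0%N).2); exists 0%N.
have ch : continuous h.
  apply/continuous_mdistP => x r r0.
  have r40 : 0 < r / 4 by rewrite divr_gt0.
  have [k ke] : exists k, (P k).2 < r / 4.
    have r4e0 : 0 < r / 4 / e by rewrite divr_gt0.
    have [k kr] := exists_invn_lt r4e0; exists k.
    apply: le_lt_trans (Pe k) _; rewrite mulrC -ltr_pdivlMr//.
    apply: le_lt_trans kr; rewrite lef_pV2 ?posrE ?exprn_gt0//.
    by rewrite -natrX ler_nat ltn_expl.
  have [cP _] := gP k.
  have [d d0 dP] := (continuous_mdistP _).1 cP x _ r40.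
  exists d => // z /dP; have := hP k x; have := hP k z.
  by rewrite !ler_norml !ltr_norml => /andP[? ?] /andP[? ?] /andP[? ?]; apply/andP; split; lra.
exists h; split=> [//|x|k]; first exact: (hP 0%N x).
by have [_ _ _] := stepP (k, P k) (gP k); apply => // x; exact: (hP k.+1 x).
Qed.

Lemma continuous_mdist x : continuous (fun z => mdist x z).
Proof.
apply/continuous_mdistP => z e e0; exists e => // w zw.
have := metric_triangle x z w; have := metric_triangle x w z.
rewrite (metric_sym w z) ltr_norml => ? ?.
by apply/andP; split; lra.
Qed.

End function_spaces.

(** * Bounding [dim_tH] through maps with small zero sets *)

Section lower_bound.
Context {R : realType} {K : metricType R}.
Hypothesis cK : compact [set: K].
Implicit Types (x z : K) (A E : set K) (F G : nat -> K -> R).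

(** Only the fiber over 0 is constrained, so the negation provides one map whose zero set stays
    large under all small perturbations. *)
Definition small_zeros_dense n s A := forall F (e c : R),
  (forall i, continuous (F i)) -> 0 < e -> 0 < c ->
  exists G, [/\ forall i, continuous (G i),
    forall i x, (i < n)%N -> `|G i x - F i x| < e &
    content_lt s c (A `&` fiber n G (fun=> 0))].

Lemma small_zeros_denseS n s A E : E `<=` A ->
  small_zeros_dense n s A -> small_zeros_dense n s E.
Proof.
move=> EA dA F e c cF e0 c0; have [G [cG GF Gc]] := dA F e c cF e0 c0.
by exists G; split=> //; apply: content_ltS Gc; exact: setSI.
Qed.

(** By separability, the property on the section need only be tested against countably many tuples
    and precisions, coded by [j]. Each test is an open dense condition on [h], so Baire category
    applies. *)
Lemma small_zeros_dense_section n s A f (e : R) : closed A ->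
  small_zeros_dense n.+1 s A -> continuous f -> 0 < e ->
  exists h : K -> R, [/\ continuous h, forall x, `|h x - f x| <= e &
    small_zeros_dense n s (A `&` h @^-1` [set 0])].
Proof.
move=> cA dA cf e0.
have [D [cD DP]] := separable_continuous cK.
pose O j : set (K -> R) := [set h | forall t : seq nat * nat, unpickle j = Some t ->
  exists G, [/\ forall i, continuous (G i),
    forall i x, (i < n)%N -> `|G i x - D (nth 0%N t.1 i) x| < t.2.+1%:R^-1 &
    content_lt s t.2.+1%:R^-1 (A `&` h @^-1` [set 0] `&` fiber n G (fun=> 0))]].
have [j g r cg r0|h [ch hf hO]] := @baire_continuous _ _ O f e cf e0; last first.
  exists h; split=> // F r c cF r0 c0.
  have r20 : 0 < r / 2 by rewrite divr_gt0.
  have [k] : exists k, k.+1%:R^-1 < Num.min (r / 2) c.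
    by apply: exists_invn_lt; rewrite lt_min r20.
  rewrite lt_min => /andP[kr kc].
  have /choice[t tP] : forall i, exists k, forall x, `|D k x - F i x| < r / 2.
    by move=> i; apply: DP.
  have [|G [cG GF Gc]] := hO (pickle (mkseq t n, k)) (mkseq t n, k).
    by rewrite pickleK.
  exists G; split=> // [i x ilt|]; last by apply: content_lt_le Gc; exact: ltW.
  have := GF i x ilt; rewrite /= nth_mkseq// => GD.
  rewrite -(subrKA (D (t i) x)) (le_lt_trans (ler_normD _ _))// (splitr r) ltrD//.
  exact: lt_trans kr.
case Et : (unpickle j : option (seq nat * nat)) => [t|]; last first.
  exists g; split=> // [x|]; first by rewrite subrr normr0.
  by exists 1 => // h' _ _ t; rewrite Et.
have k0 : 0 < t.2.+1%:R^-1 :> R by rewrite invr_gt0.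
(* With [g] as last coordinate, one perturbation of the whole tuple yields both the new [h], namely
   [G n], and the other coordinates. *)
have [||G [cG GF Gc]] := dA (fun i => if i == n then g else D (nth 0%N t.1 i))
    (Num.min r t.2.+1%:R^-1) _ _ _ k0.
- by move=> i; case: eqP.
- by rewrite lt_min r0.
have [W [oW GW Wc]] := content_lt_open Gc.
have [d d0 dW] := fiber_tube cK cA oW cG GW.
exists (G n); split=> // [x|].
  have := GF n x (ltnSn n); rewrite eqxx => /lt_le_trans; apply.
  by rewrite ge_min lexx.
exists (d / 2); first by rewrite divr_gt0.
move=> h' ch' hh' t'; rewrite Et => -[<-]; exists G; split=> // [i x ilt|].
  have := GF i x (ltnW ilt); rewrite ltn_eqF// => /lt_le_trans; apply.
  by rewrite ge_min lexx orbT.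
(* Openness of the test: at a zero of [h'] the function [G n] is at most [d / 2], so the point lies
   in a near fiber of [G]. *)
apply: content_ltS Wc => z [[Az /= hz] Gz]; apply: dW; split.
  exact: sub_thickening.
move=> i; rewrite ltnS leq_eqVlt => /orP[/eqP ->|ilt]; last first.
  by rewrite Gz// subrr normr0.
have := hh' z; rewrite hz sub0r normrN subr0 => /le_lt_trans; apply.
by rewrite ltr_pdivrMr// ltr_pMr// ltr1n.
Qed.

Lemma dim_tH_le_small_zeros n s A : 0 < s -> closed A ->
  small_zeros_dense n s A -> (dim_tH n A <= (s + n%:R)%:E)%E.
Proof.
move=> s0; elim: n A => [|n IH] A cA dA.
  rewrite /= addr0; case: ifP => _; first by rewrite lee_fin; lra.
  apply: dim_H_le => // c c0.
  have [|G [_ _]] := dA (fun _ _ => 0) 1 c _ ltr01 c0.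
    by move=> i x; exact: cst_continuous.
  by apply: content_ltS => z Az; split.
apply: dim_tHS_le => [|x e Ax e0].
  by have : 0 <= n.+1%:R :> R by []; lra.
have e40 : 0 < e / 4 by rewrite divr_gt0.
(* A function within [e / 4] of this one is negative at [x], and is negative only at distance less
   than [3 e / 4] from [x]. *)
have cm : continuous (fun z => mdist x z - e / 2).
  move=> z; apply: continuousB; [exact: continuous_mdist|exact: cst_continuous].
have [h [ch hx dh]] := small_zeros_dense_section cA dA cm e40.
have oW : open [set z | h z < 0] by exact: (open_comp (fun x _ => ch x) (@open_lt R 0)).
exists [set z | h z < 0]; split=> //=.
- by have := hx x; rewrite mdistxx ler_norml => /andP[_ ?]; lra.
- by move=> z [_ /= hz]; have := hx z; rewrite ler_norml => /andP[? _]; lra.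
rewrite -natr1 addrA addrK; apply: IH; first exact: closed_rel_boundary.
(* Relative boundary points of [{h < 0}] are zeros of [h]: positivity would persist on a
   neighborhood. *)
apply: small_zeros_denseS dh => z [[Az clz] /= nz]; split=> //=.
apply/eqP; rewrite eq_le leNgt; apply/andP; split; last by rewrite leNgt; apply/negP.
apply/negP => hz; have : nbhs z [set w | 0 < h w].
  apply: open_nbhs_nbhs; split=> //.
  exact: (open_comp (fun x _ => ch x) (@open_gt R 0)).
by move=> /clz[w [[_ /= w0] /= w1]]; lra.
Qed.

End lower_bound.

(** * Planting persistently large fibers *)

Section fat_fibers.
Context {R : realType} {K : metricType R}.
Hypothesis cK : compact [set: K].
Implicit Types (x z w : K) (A B C : set K) (F G H : nat -> K -> R).

Lemma seq_uniform_radius (T : eqType) (l : seq T) (P : R -> T -> Prop) :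
  (forall t, t \in l -> exists2 e, 0 < e & forall d, 0 < d -> d <= e -> P d t) ->
  exists2 e, 0 < e & forall t, t \in l -> forall d, 0 < d -> d <= e -> P d t.
Proof.
elim: l => [|a l IH] lP; first by exists 1.
have [|e e0 eP] := IH; first by move=> t tl; apply: lP; rewrite inE tl orbT.
have [e' e'0 e'P] := lP a (mem_head _ _).
exists (Num.min e e'); first by rewrite lt_min e0.
move=> t + d d0; rewrite le_min inE => /orP[/eqP ->|tl] /andP[de de'].
  exact: e'P.
exact: eP.
Qed.

Definition lipschitz_on A (f : K -> K) (L : R) :=
  forall x z, A x -> A z -> mdist (f x) (f z) <= L * mdist x z.

Lemma lipschitz_in_on A f : lipschitz_in A f -> exists2 L : R, 0 < L & lipschitz_on A f L.
Proof.
move=> [L fL]; exists (`|L| + 1); first by rewrite ltr_wpDl.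
move=> x z Ax Az; apply: le_trans (fL _ _ Ax Az) _.
rewrite ler_wpM2r ?mdist_ge0//.
by rewrite (le_trans (ler_norm L))// lerDl.
Qed.

Lemma within_continuous_lipschitz A f L (g : K -> R) : 0 < L -> lipschitz_on A f L ->
  continuous g -> {within A, continuous (g \o f)}.
Proof.
move=> L0 fL /continuous_mdistP cg; apply/subspace_continuousP => x Ax.
apply/cvgrPdist_lt => e e0; rewrite near_withinE.
have [d d0 dg] := cg (f x) e e0.
apply/near_mdistP; exists (d / L); first by rewrite divr_gt0.
move=> z /= xz Az; rewrite distrC; apply: dg.
by apply: le_lt_trans (fL _ _ Ax Az) _; rewrite mulrC -ltr_pdivlMr.
Qed.

Lemma continuous_lipschitz f L (g : K -> R) : 0 < L -> lipschitz_on setT f L ->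
  continuous g -> continuous (g \o f).
Proof.
move=> L0 fL cg; apply/continuous_subspace_setT.
exact: within_continuous_lipschitz L0 fL cg.
Qed.

(** Since [f] is controlled only on [A], each ball meeting [A] is recentered at a point of [A],
    which doubles its radius before [f] is applied. *)
Lemma content_lt_image A B f (L s c : R) : 0 < L -> lipschitz_on A f L ->
  content_lt s c B -> content_lt s ((L * 2) `^ s * c) (f @` (A `&` B)).
Proof.
move=> L0 fL [l [/allP l0 Bl lc]].
have /choice[v vP] : forall p : K * R, exists v : K,
    forall z, A z -> mdist p.1 z < p.2 -> A v /\ mdist p.1 v < p.2.
  move=> p; have [[v vp]|nv] := pselect (exists v, A v /\ mdist p.1 v < p.2).
    by exists v.
  by exists p.1 => z Az pz; exfalso; apply: nv; exists z.
exists [seq (f (v p), L * 2 * p.2) | p <- l]; split.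
- by apply/allP => _ /mapP[p /l0 p0 ->] /=; rewrite !mulr_gt0.
- move=> _ [z [Az Bz] <-]; have [p pl pz] := Bl _ Bz.
  exists (f (v p), L * 2 * p.2); first by apply/mapP; exists p.
  have [Av pv] := vP p z Az pz; apply: le_lt_trans (fL _ _ Av Az) _ => /=.
  rewrite -mulrA ltr_pM2l// mulr_natl mulr2n.
  by rewrite (le_lt_trans (metric_triangle (v p) p.1 z))// ltrD// metric_sym.
- rewrite big_map /= (eq_big_seq (fun p : K * R => (L * 2) `^ s * p.2 `^ s)).
    by rewrite -mulr_sumr ltr_pM2l// powR_gt0// mulr_gt0.
  by move=> p /l0 p0; rewrite powRM// ?mulr_ge0// ltW.
Qed.

Definition clamp (e t : R) := Num.max (- e) (Num.min e t).

Lemma clamp_le e t : 0 <= e -> `|clamp e t| <= e.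
Proof.
move=> e0; rewrite ler_norml /clamp le_max lexx /= ge_max ge_min lexx /= andbT.
lra.
Qed.

Lemma clamp_id e t : `|t| < e -> clamp e t = t.
Proof.
rewrite ltr_norml => /andP[t1 t2]; rewrite /clamp (min_idPr _) ?(ltW t2)//.
by rewrite (max_idPr _)// ltW.
Qed.

Lemma clamp_lipschitz e t t' : `|clamp e t - clamp e t'| <= `|t - t'|.
Proof.
rewrite /clamp; have := ler_norm (t - t'); have := ler_norm (t' - t).
rewrite (distrC t' t) => ? ?; have ? := normr_ge0 (t - t').
case: (leP e t) => ?; case: (leP e t') => ?; case: (leP (- e) e) => ?;
  case: (leP (- e) t) => ?; case: (leP (- e) t') => ?;
  by rewrite ler_norml; apply/andP; split; lra.
Qed.

Lemma continuous_clamp e (M : R) (f : K -> R) : continuous f ->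
  continuous (fun x => clamp e (M * f x)).
Proof.
move=> cf; have cMf : continuous (fun x => M * f x).
  by move=> x; apply: cvgM; [exact: cvg_cst|exact: cf].
apply/continuous_mdistP => x d d0.
have [r r0 rf] := (continuous_mdistP _).1 cMf x d d0.
by exists r => // z /rf; apply: le_lt_trans; exact: clamp_lipschitz.
Qed.

(* The map [F] is planted, truncated and suitably rescaled, on small copies of
   [K] around finitely many points [x_j] whose images form a net of the range of
   [F0]; every value of [F0] then lies in the range of one of the copies. *)
Lemma fat_fibers_perturbation n s F (e0 c0 : R) F0 (e : R) :
  weakly_self_similar K -> 0 < e0 -> 0 < c0 ->
  (forall i, continuous (F i)) ->
  (forall G, (forall i, continuous (G i)) ->
    (forall i x, (i < n)%N -> `|G i x - F i x| < e0) ->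
    ~ content_lt s c0 (fiber n G (fun=> 0))) ->
  (forall i, continuous (F0 i)) -> 0 < e ->
  exists F1, [/\ forall i, continuous (F1 i), forall i x, `|F1 i x - F0 i x| <= e &
    exists2 d, 0 < d & forall H, (forall i, continuous (H i)) ->
      (forall i x, (i < n)%N -> `|H i x - F1 i x| < d) ->
      forall y, fiber n F0 y !=set0 ->
        exists2 c, 0 < c & ~ content_lt s c (fiber n H y)].
Proof.
move=> sK e00 c00 cF Ffat cF0 e_gt0.
(* One [h] pays for the planted function, truncated at [h], the other for the oscillation of [F0] on
   a copy. *)
pose h := e / 2; have h0 : 0 < h by rewrite divr_gt0.
have h20 : 0 < h / 2 by rewrite divr_gt0.
have modulus (d : R) : 0 < d -> exists2 r, 0 < r &
    forall i x z, (i < n)%N -> mdist x z < r -> `|F0 i z - F0 i x| < d.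
  move=> d0; have [i _|r r0 rP] := @seq_uniform_radius _ (iota 0 n)
    (fun r i => forall x z, mdist x z < r -> `|F0 i z - F0 i x| < d).
    have [r r0 rP] := uniformly_continuous_mdist cK (cF0 i) d0.
    by exists r => // r' _ r'r x z xz; apply: rP; exact: lt_le_trans r'r.
  exists r => // i x z ilt; apply: (rP i) => //.
  by rewrite mem_iota.
have [r1 r10 r1P] := modulus _ h20.
have [r2 r20 r2P] := modulus _ h0.
have [||l' [_ l'P]] := @finite_subcover _ _ setT (fun x => [set z | mdist x z < r1]) cK.
- by move=> x _; exact: open_mdist_lt.
- by move=> x _ /=; rewrite mdistxx.
pose l := undup l'.
have lP z : exists2 x, x \in l & mdist x z < r1.
  by have [x xl xz] := l'P z I; exists x => //; rewrite mem_undup.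
have [r3 r30 r3P] : exists2 r3, 0 < r3 &
    forall x z, x \in l -> z \in l -> x != z -> r3 <= mdist x z.
  have [x xl|r r0 rP] := @seq_uniform_radius _ l
    (fun r x => forall z, z \in l -> x != z -> r <= mdist x z).
    have [z zl|r r0 rP] := @seq_uniform_radius _ l
      (fun r z => x != z -> r <= mdist x z).
      have [->|xz] := eqVneq x z; first by exists 1 => // d _ _; rewrite eqxx.
      by exists (mdist x z); rewrite ?mdist_gt0.
    by exists r => // d d0 dr z zl; exact: rP.
  by exists r => // x z xl; apply: (rP x).
have [lnil|[x0 _]] : l = [::] \/ exists x0 : K, True.
  by case: (l) => [|x0 ?]; [left|right; exists x0].
  exists F0; split=> // [i x|]; first by rewrite subrr normr0 ltW.
  by exists 1 => // H _ _ y [x _]; have [z] := lP x; rewrite lnil.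
(* Net points are at least [r3] apart, so balls of radius [r3 / 3] around them are disjoint. *)
pose r := Num.min (r2 / 2) (r3 / 3).
have r0 : 0 < r by rewrite lt_min !divr_gt0.
pose p j := nth x0 l j.
have /choice[C /choice[phi /choice[psi CP]]] : forall j, exists C phi psi, [/\ compact C,
    C `<=` [set z | mdist (p j) z <= r],
    (forall w, C (psi w) /\ phi (psi w) = w),
    (exists2 L, 0 < L & lipschitz_on C phi L) &
    (exists2 L, 0 < L & lipschitz_on setT psi L)].
  move=> j; have [C [cC Cr [phi [[_ _ surj] lphi [psi phiK lpsi]]]]] := sK (p j) r r0.
  exists C, phi, psi; split=> //; [|exact: lipschitz_in_on..].
  move=> w; have [x Cx <-] := surj w I.
  by rewrite phiK ?mem_set.
(* This scale turns an error below [h] in the planted copy into an error below [e0] in [F]. *)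
pose M := h / e0; have M0 : 0 < M by rewrite divr_gt0.
pose V i x := clamp h (M * F i x).
have cV i : continuous (V i) by exact: continuous_clamp.
(* Adding [u i j] to [F0 i] leaves on [C j] the copy of [V i] translated by the value at the
   center. *)
pose u i j x := F0 i (p j) + V i (phi j x) - F0 i x.
have dC i j x : (i < j)%N -> (j < size l)%N -> C i x -> ~ C j x.
  move=> ij jl Ci Cj; have il := ltn_trans ij jl.
  have [_ /(_ _ Ci)/= pix _ _ _] := CP i; have [_ /(_ _ Cj)/= pjx _ _ _] := CP j.
  have : r3 <= mdist (p i) (p j).
    apply: r3P; [exact: mem_nth..|].
    by rewrite /p nth_uniq ?undup_uniq// neq_ltn ij.
  have := metric_triangle (p i) x (p j); rewrite (metric_sym x).
  have : r <= r3 / 3 by rewrite ge_min lexx orbT.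
  by move: r30 pix pjx; lra.
have /choice[g gP] : forall i, exists g : K -> R, [/\ continuous g,
    forall x, `|g x| <= e & (i < n)%N ->
    forall j x, (j < size l)%N -> C j x -> g x = u i j x].
  move=> i; have [ilt|nilt] := pselect (i < n)%N; last first.
    exists (fun=> 0); split=> // [x|x]; first exact: cst_continuous.
    by rewrite normr0 ltW.
  have [j jl|j jl|j x jl Cx|g [cg ge gu]] :=
      @paste_extension _ _ (size l) C (u i) e cK e_gt0 _ dC.
  - by have [cC _ _ _ _] := CP j; apply: compact_closed => //; exact: metric_hausdorff.
  - have [_ _ _ [L L0 phiL] _] := CP j.
    have cVphi : {within C j, continuous (V i \o phi j)}.
      exact: within_continuous_lipschitz L0 phiL (cV i).
    move=> x; apply: cvgB; last exact: (continuous_subspaceT (cF0 i)).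
    by apply: cvgD; [exact: cvg_cst|exact: cVphi].
  - have [_ /(_ _ Cx)/= px _ _ _] := CP j.
    have : `|F0 i x - F0 i (p j)| < h.
      apply: r2P => //; apply: (le_lt_trans px).
      by rewrite gt_min ltr_pdivrMr// ltr_pMr// ltr1n.
    have := clamp_le (M * F i (phi j x)) (ltW h0).
    rewrite /u -/(V i (phi j x)) ler_norml ltr_norml => /andP[? ?] /andP[? ?].
    have eh : e = h + h by rewrite /h -splitr.
    by rewrite ler_norml eh; apply/andP; split; lra.
  - by exists g.
exists (fun i => F0 i \+ g i); split.
- by move=> i x; apply: continuousD; [exact: cF0|have [cg _ _] := gP i; exact: cg].
- by move=> i x /=; rewrite addrC addKr; have [] := gP i.
(* A point [z] over [y] selects the copy: its net point has a value within [h / 2] of [y], and [H]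
   adds another error of [h / 2]. *)
exists (h / 2) => // H cH HF1 y [z zy].
have [x xl xz] := lP z.
pose j := index x l; have jl : (j < size l)%N by rewrite index_mem.
have pj : p j = x by rewrite /p nth_index.
have [_ _ psiK [L L0 phiL] [L' L'0 psiL]] := CP j.
(* Pulled back by [psi j] and rescaled, [H] becomes a perturbation [G] of [F], whose zero set is
   therefore large. *)
pose G i w := F i w + M^-1 * (H i (psi j w) - y i - V i w).
have GH i w : (i < n)%N -> `|H i (psi j w) - y i - V i w| < h.
  move=> ilt; have [Cw phiw] := psiK w.
  have [_ _ /(_ ilt _ _ jl Cw)] := gP i; rewrite /u phiw pj => gw.
  have := HF1 i (psi j w) ilt; rewrite /= gw.
  have := r1P i x z ilt xz; rewrite zy//.
  rewrite !ltr_norml => /andP[? ?] /andP[? ?].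
  have hh : h = h / 2 + h / 2 by rewrite -splitr.
  by rewrite {1 2}hh; apply/andP; split; lra.
have cG i : continuous (G i).
  move=> w; apply: cvgD; first exact: cF.
  apply: cvgM; first exact: cvg_cst.
  apply: cvgB; last exact: cV.
  apply: cvgB; last exact: cvg_cst.
  exact: (continuous_lipschitz L'0 psiL (cH i)).
have GF i w : (i < n)%N -> `|G i w - F i w| < e0.
  move=> ilt; rewrite /G addrC addKr normrM gtr0_norm ?invr_gt0//.
  rewrite mulrC ltr_pdivrMr// /M mulrCA divff ?gt_eqF// mulr1.
  exact: GH.
have k0 : 0 < (L * 2) `^ s by rewrite powR_gt0// mulr_gt0.
exists (c0 / (L * 2) `^ s); first by rewrite divr_gt0.
move=> /(content_lt_image L0 phiL); rewrite mulrCA divff ?gt_eqF// mulr1.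
move=> Hc; apply: (Ffat G cG GF); apply: content_ltS Hc => w wG.
have [Cw phiw] := psiK w; exists (psi j w) => //; split=> // i ilt.
(* At a zero of [G], [M * F i w] has absolute value below [h], so the truncation is inactive and [H]
   takes the value [y] at [psi j w]. *)
have := wG i ilt; rewrite /G => /eqP; rewrite addr_eq0 => /eqP Fw.
have MF : M * F i w = - (H i (psi j w) - y i - V i w).
  by rewrite Fw mulrN mulrA divff ?gt_eqF// mul1r.
have Vw : V i w = M * F i w.
  by rewrite /V clamp_id// MF normrN GH.
by move: MF; rewrite -Vw; lra.
Qed.

End fat_fibers.

(** * Co-meager sets from countably many conditions *)

Section comeager_sets.
Context {T : topologicalType}.

Lemma comeager_countable (I : countType) (S : I -> set T) (A : set T) :
  (forall i, nowhere_dense (~` S i)) -> \bigcap_i S i `<=` A -> comeager A.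
Proof.
move=> dS SA.
(* Meagerness asks for an equality, so each piece is cut down to the complement of [A]; numbers
   coding no index contribute the empty set. *)
exists (fun k => ~` A `&` (if unpickle k is Some i then ~` S i else set0)).
  move=> k; rewrite /nowhere_dense; case: (unpickle k) => [i|]; last first.
    by rewrite setI0 closure0 (iffLR (interior_id _) open0).
  rewrite -subset0 -(dS i); apply: interiorS; apply: closure_subset.
  exact: subIsetr.
apply/seteqP; split=> [x nAx|x [k _ []]//].
have [i nS] : exists i, ~ S i x.
  apply: contrapT => nS; apply/nAx/SA => i _.
  by apply: contrapT => Six; apply: nS; exists i.
by exists (pickle i) => //; split=> //; rewrite pickleK.
Qed.

End comeager_sets.

(** * Coordinates of row vectors *)

Section row_vectors.
Context {R : realType} {n : nat}.

Lemma row_norm_lt (v : 'rV[R]_n) (e : R) : 0 < e ->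
  (`|v| < e) <-> (forall j, `|v 0 j| < e).
Proof.
move=> e0; have -> : (`|v| < e) = (ball (0 : 'rV[R]_n) e v) :> Prop.
  by rewrite -ball_normE /= sub0r normrN.
split=> [[_ h] j|h].
  by have := h 0 j; rewrite -ball_normE/= mxE sub0r normrN.
split=> // i j; rewrite (ord1 i) -ball_normE/= mxE sub0r normrN.
exact: h.
Qed.

(** Indexing by [nat], with default 0, matches the encoding of maps as sequences of functions. *)
Definition vnth (v : 'rV[R]_n) (i : nat) : R :=
  if insub i is Some j then v 0 j else 0.

Lemma vnthE v (j : 'I_n) : vnth v j = v 0 j.
Proof. by rewrite /vnth valK. Qed.

Lemma continuous_vnth i : continuous (fun v : 'rV[R]_n => vnth v i).
Proof.
rewrite /vnth; case: (insub i) => [j|]; last exact: cst_continuous.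
exact: coord_continuous.
Qed.

End row_vectors.

(** * Elements of [Cfun] as sequences of coordinate functions *)

Section continuous_maps.
Context {R : realType} {K : metricType R} {n : nat}.
Hypothesis cK : compact [set: K].
Implicit Types (f g : Cfun R K n) (F G : nat -> K -> R).

Definition coord f (i : nat) (x : K) : R := vnth (f x) i.

Lemma continuous_coord f i : continuous (coord f i).
Proof.
move=> x; apply: (@continuous_comp _ _ _ (f : K -> _) (fun v => vnth v i)).
  exact: cts_fun.
exact: continuous_vnth.
Qed.

Lemma exists_Cfun F : (forall i, continuous (F i)) ->
  exists f, forall i x, (i < n)%N -> coord f i x = F i x.
Proof.
move=> cF; pose h x : 'rV[R]_n := \row_(i < n) F i x.
have ch : continuous h.
  move=> x; apply/cvgrPdist_lt => e e0.
  have : \forall z \near x, forall j : 'I_n, `|F j x - F j z| < e.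
    apply: filter_forall => j.
    by have /cvgrPdist_lt := cF j x; apply.
  apply: filterS => z Fz; apply/row_norm_lt => // j.
  by rewrite !mxE; exact: Fz.
exists (HB.pack_for (continuousType K 'rV[R]_n) h (@isContinuous.Build K _ h ch)).
by move=> i x ilt; rewrite /coord (vnthE _ (Ordinal ilt)) /= mxE.
Qed.

Lemma sup_dist_lt f g (e d : R) : 0 < e -> e < d ->
  (forall i x, (i < n)%N -> `|coord f i x - coord g i x| < e) -> sup_dist f g < d.
Proof.
move=> e0 ed fg; apply: le_lt_trans ed; rewrite /sup_dist.
have [->|/set0P S0] := eqVneq [set `|f x - g x| | x in [set: K]] set0.
  by rewrite sup0 ltW.
apply: ge_sup => // _ [x _ <-]; apply/ltW/row_norm_lt => // j.
by have := fg j x (ltn_ord j); rewrite /coord !vnthE !mxE.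
Qed.

Lemma lt_sup_dist f g (d : R) : 0 < d -> sup_dist f g < d ->
  forall i x, (i < n)%N -> `|coord f i x - coord g i x| < d.
Proof.
move=> d0 fg i x ilt.
have : compact ((fun x => `|f x - g x|) @` [set: K]).
  apply: continuous_compact => //; apply: continuous_subspaceT => z.
  apply: (@continuous_comp _ _ _ (fun x => f x - g x)); last exact: norm_continuous.
  by apply: cvgB; apply: cts_fun.
move=> /compact_bounded [M [_ /(_ (M + 1))]]; rewrite ltrDl ltr01 => /(_ isT) Mb.
have /row_norm_lt-/(_ d0 (Ordinal ilt)) : `|f x - g x| < d.
  apply: le_lt_trans fg; apply: ub_le_sup; last by exists x.
  by exists (M + 1) => y /Mb; apply: le_trans; exact: ler_norm.
by rewrite !mxE /coord !(vnthE _ (Ordinal ilt)).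
Qed.

Lemma nowhere_dense_setC (S : set (Cfun R K n)) :
  (forall F (e : R), (forall i, continuous (F i)) -> 0 < e ->
    exists G, [/\ forall i, continuous (G i), forall i x, `|G i x - F i x| <= e &
    exists2 d, 0 < d & forall g, (forall i x, (i < n)%N -> `|coord g i x - G i x| < d) ->
      S g]) ->
  nowhere_dense (~` S).
Proof.
move=> dS; rewrite /nowhere_dense -subset0 => f /(nbhs_CfunP cK)[e e0 eS].
have e30 : 0 < e / 3 by rewrite divr_gt0.
have [G [cG Gf [d d0 dG]]] := dS (coord f) _ (@continuous_coord f) e30.
have [g gG] := exists_Cfun cG.
have /eS gS : sup_dist f g < e.
  apply: (@sup_dist_lt _ _ (e / 2)); first by rewrite divr_gt0.
    by rewrite ltr_pdivrMr// ltr_pMr// ltr1n.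
  move=> i x ilt; rewrite gG// distrC; apply: le_lt_trans (Gf _ _) _.
  by rewrite ltr_pM2l// ltf_pV2 ?posrE// ltr_nat.
have /gS[h [nSh /= gh]] : nbhs g [set h | sup_dist g h < d].
  by apply/(nbhs_CfunP cK); exists d.
apply: nSh; apply: dG => i x ilt; rewrite -gG// distrC.
exact: lt_sup_dist.
Qed.

Lemma preimage_fiber f (v : 'rV[R]_n) : f @^-1` [set v] = fiber n (coord f) (vnth v).
Proof.
apply/seteqP; split=> [x /= fx i ilt|x fx]; first by rewrite /coord fx.
apply/rowP => j; have := fx j (ltn_ord j).
by rewrite /coord !vnthE.
Qed.

End continuous_maps.

(** * Generic size of fibers, and the theorem *)

Section generic_fibers.
Context {R : realType} {K : metricType R}.
Hypothesis cK : compact [set: K].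

Lemma nowhere_dense_large_fibers n (s c : R) : 0 < s -> 0 < c ->
  (dim_tH n [set: K] < (s + n%:R)%:E)%E ->
  nowhere_dense (~` [set f : Cfun R K n |
    forall y, content_lt s c (fiber n (coord f) y)]).
Proof.
move=> s0 c0 dK; apply: nowhere_dense_setC => // F e cF e0.
have [G [cG GF Gc]] :=
  small_fibers_dense_dim_tH cK s0 (@closedT K) dK cF e0 c0.
have [d d0 dG] := content_lt_thickening cK (@closedT K) c0 cG Gc.
exists G; split=> // [i x|]; first exact: ltW.
exists d => // g gG y; apply: content_ltS (dG y) => x xy; split.
  exact: sub_thickening.
by move=> i ilt; rewrite -(xy i ilt) distrC; exact: gG.
Qed.

Definition box n (q : nat -> R) (r : R) : set (nat -> R) :=
  [set y | forall i, (i < n)%N -> `|y i - q i| < r].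

(** If [F0] misses a point of [B], compactness makes all nearby maps miss it. Otherwise every fiber
    over [B] is nonempty, and large fibers can be planted over all of [B] at once. *)
Lemma nowhere_dense_thin_fibers n (s : R) (B : set (nat -> R)) :
  weakly_self_similar K -> 0 < s -> ((s + n%:R)%:E < dim_tH n [set: K])%E ->
  nowhere_dense (~` [set f : Cfun R K n |
    (exists2 y, B y & fiber n (coord f) y = set0) \/
    (forall y, B y -> exists2 c, 0 < c & ~ content_lt s c (fiber n (coord f) y))]).
Proof.
move=> sK s0 dK; apply: nowhere_dense_setC => // F0 e cF0 e0.
have [[y By Fy]|nF] := pselect (exists2 y, B y & fiber n F0 y = set0).
  have [|d d0 dF] := @fiber_tube _ _ n F0 setT set0 y cK closedT open0 cF0.
    by rewrite setTI Fy.
  exists F0; split=> // [i x|]; first by rewrite subrr normr0 ltW.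
  exists d => // g gF; left; exists y => //; rewrite -subset0 => x xy.
  apply: (dF x); split; first exact: sub_thickening.
  by move=> i ilt; rewrite -(xy i ilt) distrC; exact: gF.
have : ~ small_zeros_dense n s [set: K].
  move=> /(dim_tH_le_small_zeros cK s0 closedT).
  by rewrite leNgt dK.
move=> /existsNP[F /existsNP[e1 /existsNP[c1]]].
move=> /not_implyP[cF /not_implyP[e10 /not_implyP[c10 nG]]].
have [|F1 [cF1 F1F [d d0 dF]]] :=
    @fat_fibers_perturbation _ _ cK n s F e1 c1 F0 e sK e10 c10 cF _ cF0 e0.
  by move=> G cG GF Gc; apply: nG; exists G; split=> //; rewrite setTI.
exists F1; split=> //; exists d => // g gF; right=> y By; apply: dF => //.
  exact: continuous_coord.
by apply/set0P/negP => /eqP Fy; apply: nF; exists y.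
Qed.

Lemma closed_fiber n (f : Cfun R K n) y : closed (fiber n (coord f) y).
Proof.
have -> : fiber n (coord f) y =
    \bigcap_(i in [set i | (i < n)%N]) (coord f i @^-1` [set y i]).
  by apply/seteqP; split=> x xy i ilt; exact: xy.
apply: closed_bigI => i _; apply: closed_comp; last exact: closed_eq.
by move=> x _; exact: continuous_coord.
Qed.

(** Rational centers and radii [1/(k+1)] leave countably many boxes, hence countably many conditions
    on the generic map. *)
Lemma box_sub_range n (f : Cfun R K n) (v : 'rV[R]_n) : (range f)° v ->
  exists (q : seq rat) (k : nat), box n (fun i => ratr q`_i) k.+1%:R^-1 (vnth v) /\
    forall y, box n (fun i => ratr q`_i) k.+1%:R^-1 y -> fiber n (coord f) y !=set0.
Proof.
move=> /nbhs_ballP[r /= r0 rf].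
have r20 : 0 < r / 2 by rewrite divr_gt0.
have [k kr] := exists_invn_lt r20.
have k0 : 0 < k.+1%:R^-1 :> R by rewrite invr_gt0.
have /choice[q qP] : forall i, exists q : rat, `|vnth v i - ratr q| < k.+1%:R^-1.
  move=> i; have [|q] := @rat_in_itvoo R (vnth v i) (vnth v i + k.+1%:R^-1).
    by rewrite ltrDl.
  rewrite in_itv/= => /andP[xq qx]; exists q.
  move: xq qx; set t : R := ratr q; set w : R := k.+1%:R^-1 => xq qx.
  by rewrite ltr_norml; apply/andP; split; lra.
exists (mkseq q n), k; split=> [i ilt|y yq]; first by rewrite nth_mkseq.
have [x _ fx] : range f (\row_(i < n) y i).
  apply: rf; rewrite -ball_normE /=; apply/row_norm_lt => // j.
  rewrite !mxE -(vnthE v j); have := qP j; have := yq j (ltn_ord j).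
  rewrite nth_mkseq//; move: kr; set w : R := _^-1; set t : R := ratr _.
  rewrite !ltr_norml => ? /andP[? ?] /andP[? ?].
  have rr : r = r / 2 + r / 2 by rewrite -splitr.
  by rewrite rr; apply/andP; split; lra.
exists x => i ilt; rewrite /coord fx (vnthE _ (Ordinal ilt)).
by rewrite mxE.
Qed.

End generic_fibers.

Theorem theorem7p9 (R : realType) (n : nat) (hn : (0 < n)%N)
    (K : metricType R) (cK : compact [set: K]) (sK : weakly_self_similar K)
    (dK : (n%:R%:E <= dim_t [set: K] :> \bar R)%E) :
  comeager [set f : Cfun R K n | forall y : 'rV[R]_n, (range f)° y ->
    dim_H (f @^-1` [set y]) = (dim_tH n [set: K] - n%:R%:E)%E].
Proof.
set D := dim_tH n [set: K].
(* This makes every rational exponent above [D - n] positive, as the content lemmas require. *)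
have nD : (n%:R%:E <= D)%E.
  rewrite leNgt; apply/negP => /dim_tH_small_ind/(dim_t_le (R := R)) /(le_trans dK).
  by rewrite lee_fin; lra.
pose small (s : rat) (k : nat) : set (Cfun R K n) :=
  if (0 < ratr s :> R) && (D < (ratr s + n%:R)%:E)%E then
    [set f | forall y, content_lt (ratr s) k.+1%:R^-1 (fiber n (coord f) y)]
  else setT.
pose large (q : seq rat) (k : nat) (s : rat) : set (Cfun R K n) :=
  let B := box n (fun i => ratr q`_i) k.+1%:R^-1 in
  if (0 < ratr s :> R) && ((ratr s + n%:R)%:E < D)%E then
    [set f | (exists2 y, B y & fiber n (coord f) y = set0) \/
      (forall y, B y -> exists2 c, 0 < c & ~ content_lt (ratr s) c (fiber n (coord f) y))]
  else setT.
have nd0 : nowhere_dense (~` [set: Cfun R K n]).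
  by rewrite /nowhere_dense setCT closure0 (iffLR (interior_id _) open0).
apply: (@comeager_countable _ (rat * nat + seq rat * nat * rat)%type
  (fun t => match t with inl (s, k) => small s k | inr (q, k, s) => large q k s end)).
  move=> [[s k]|[[q k] s]].
    rewrite /small; case: ifP => // /andP[s0 sD].
    exact: nowhere_dense_large_fibers.
  rewrite /large; case: ifP => // /andP[s0 sD].
  exact: nowhere_dense_thin_fibers.
move=> f fS v fv; rewrite preimage_fiber; set Z := fiber _ _ _.
have [q [k [vq qf]]] := box_sub_range fv.
have Z0 : Z !=set0 by exact: qf.
have cZ : compact Z by apply: subclosed_compact cK _ => //; exact: closed_fiber.
have upper (s : rat) : 0 < ratr s :> R -> (D < (ratr s + n%:R)%:E)%E ->
    (dim_H Z <= (ratr s)%:E)%E.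
  move=> s0 sD; apply: dim_H_le => // c c0; have [m mc] := exists_invn_lt c0.
  have := fS (inl (s, m)) I; rewrite /small s0 sD => /(_ (vnth v)).
  by apply: content_lt_le; exact: ltW.
have lower (s : rat) : 0 < ratr s :> R -> ((ratr s + n%:R)%:E < D)%E ->
    ((ratr s)%:E <= dim_H Z)%E.
  move=> s0 sD; have := fS (inr (q, k, s)) I; rewrite /large s0 sD.
  move=> [[y /qf[x xy] y0]|/(_ _ vq)[c c0 nc]]; last exact: dim_H_ge nc.
  by move: xy; rewrite y0.
apply/eqP; rewrite eq_le; apply/andP; split.
  case ED : D nD => [d| |]// nd; last by rewrite leey.
  rewrite lee_fin in nd; rewrite -EFinB; apply/lee_addgt0Pr => e e0; rewrite -EFinD.
  have [|s] := @rat_in_itvoo R (d - n%:R) (d - n%:R + e); first by rewrite ltrDl.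
  rewrite in_itv/= => /andP[ds se].
  apply: (@le_trans _ _ (ratr s)%:E); last by rewrite lee_fin ltW.
  apply: upper; first by apply: le_lt_trans ds; rewrite subr_ge0.
  by rewrite ED lte_fin -ltrBlDr.
(* A rational [s] strictly between [dim_H Z] and [D - n] would contradict [lower]; it is positive
   because [Z] is nonempty. An infinite [D] is treated separately. *)
rewrite leNgt; apply/negP => ZD.
have := dim_H_ge0 Z0; case EZ : (dim_H Z) ZD => [h| |]// ZD; last first.
  by move: ZD; rewrite ltNge leey.
rewrite lee_fin => h0.
have [s hs sD] : exists2 s : rat, h < ratr s & ((ratr s + n%:R)%:E < D)%E.
  case: (D) nD ZD => [d| |]// _ ZD; last first.
    have [|s] := @rat_in_itvoo R h (h + 1); first by rewrite ltrDl.
    by rewrite in_itv/= => /andP[hs _]; exists s => //; exact: ltry.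
  have [|s] := @rat_in_itvoo R h (d - n%:R); first by rewrite -lte_fin.
  rewrite in_itv/= => /andP[hs sd]; exists s => //.
  by rewrite lte_fin -ltrBrDr.
have := lower s (le_lt_trans h0 hs) sD.
by rewrite EZ lee_fin leNgt hs.
Qed.
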